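(* Let $\Omega\subset\mathbb{R}^2$ be a closed region bounded by an ellipse, containing the Kepler center $O$ in its interior, and consider the Kepler billiard in $\Omega$ with center $O$ on its zero-energy level. Suppose that this zero-energy Kepler billiard has an invariant curve $\Gamma$ consisting of $2$-periodic points, and that the region $\mathcal{A}$ between $\Gamma$ and the boundary admits a $C^1$ first integral with non-vanishing gradient on $\mathcal{A}$. Then $O$ is a focus of the ellipse $\partial\Omega$.
   Context: Kepler billiard. Identify $\mathbb{R}^2\cong\mathbb{C}$ with the Kepler center $O$ at the origin. The Kepler problem is the Hamiltonian system of $H(p,q)=\frac{|p|^2}{2}-\frac{1}{|q|}$ on the phase space $\{(q,p): q\in\mathbb{C}\setminus\{O\},\ p\in\mathbb{C}\}$ with its standard symplectic form. At zero energy $H=0$, its orbits are the parabolas with focus $O$, together with degenerate radial orbits. The radial orbits are continued through collision by Levi-Civita regularization, i.e. the particle bounces back along the same ray. The (zero-energy) Kepler billiard in a closed region $\Omega$ is the motion in $\Omega$ of a particle moving along zero-energy Kepler orbits and reflected elastically at $\partial\Omega$ (angle of incidence equals angle of reflection). Billiard map. At zero energy the speed at $q$ is determined by $|p|=\sqrt{2/|q|}$. The state of the particle just after a reflection is therefore given by a point of the phase cylinder $\partial\Omega\times(0,\pi)$, i.e. the reflection point and the angle between the oriented boundary and the inward-pointing velocity. The billiard map $T$ sends such a state to the state just after the next reflection (where defined). The boundary components of the phase cylinder are $\partial\Omega\times\{0\}$ and $\partial\Omega\times\{\pi\}$. Invariant curve of $2$-periodic points. This is a continuous simple closed curve $\Gamma$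 in the phase cylinder, not contractible in it (a rotational curve), with $T(\Gamma)=\Gamma$, each of whose points $x$ satisfies $T^2(x)=x$ and $T(x)\neq x$. Region $\mathcal{A}$ and first integral. $\mathcal{A}$ is the open region of the phase cylinder between $\Gamma$ and a boundary component of the phase cylinder. A $C^1$ first integral with non-vanishing gradient on $\mathcal{A}$ is a $C^1$ function $F:\mathcal{A}\to\mathbb{R}$ with $F(T(x))=F(x)$ whenever $x,T(x)\in\mathcal{A}$, and $dF\neq 0$ at every point of $\mathcal{A}$. The center of a circle is regarded as its (double) focus. *)

(* Defs.v *)
From mathcomp Require Import all_boot all_order all_algebra.
From mathcomp Require Import all_classical all_reals all_analysis.
Set Implicit Arguments.
Unset Strict Implicit.
Unset Printing Implicit Defensive.
Import Order.TTheory GRing.Theory Num.Theory.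
Import numFieldNormedType.Exports.
Local Open Scope classical_set_scope.
Local Open Scope ring_scope.

(* The library norm on [R * R] is the sup norm: it is used only for topology and
   differentiation, where it is equivalent to the Euclidean norm [enorm]. *)
Definition dot (R : realType) (v w : R * R) : R := v.1 * w.1 + v.2 * w.2.
Definition enorm (R : realType) (v : R * R) : R := Num.sqrt (dot v v).

Definition rotate (R : realType) (phi : R) (v : R * R) : R * R :=
  (cos phi * v.1 - sin phi * v.2, sin phi * v.1 + cos phi * v.2).

Record ellipse (R : realType) := Ellipse {
  ellipse_center : R * R;
  axis_angle : R;
  semi_major : R;
  semi_minor : R;
  semi_minor_gt0 : 0 < semi_minor;
  semi_minor_le : semi_minor <= semi_major
}.

Definition ellipse_fun (R : realType) (E : ellipse R) (x : R * R) : R :=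
  let y := rotate (- axis_angle E) (x - ellipse_center E) in
  (y.1 / semi_major E) ^+ 2 + (y.2 / semi_minor E) ^+ 2.

Definition ellipse_curve (R : realType) (E : ellipse R) : set (R * R) :=
  [set x | ellipse_fun E x = 1].
Definition ellipse_region (R : realType) (E : ellipse R) : set (R * R) :=
  [set x | ellipse_fun E x <= 1].

(* For a circle both foci are the center. *)
Definition is_focus (R : realType) (E : ellipse R) (x : R * R) : Prop :=
  let c := Num.sqrt (semi_major E ^+ 2 - semi_minor E ^+ 2) in
  x = ellipse_center E + rotate (axis_angle E) (c, 0) \/
  x = ellipse_center E - rotate (axis_angle E) (c, 0).

(* Counterclockwise parametrization of [ellipse_curve E], 2 pi-periodic. *)
Definition ellipse_pt (R : realType) (E : ellipse R) (s : R) : R * R :=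
  ellipse_center E +
  rotate (axis_angle E) (semi_major E * cos s, semi_minor E * sin s).

Definition unit_tangent (R : realType) (E : ellipse R) (s : R) : R * R :=
  let v := derive1 (ellipse_pt E) s in (enorm v)^-1 *: v.

(* Quarter turn counterclockwise of the tangent. *)
Definition inward_normal (R : realType) (E : ellipse R) (s : R) : R * R :=
  let v := unit_tangent E s in (- v.2, v.1).

Definition hamiltonian (R : realType) (q p : R * R) : R :=
  enorm p ^+ 2 / 2 - (enorm q)^-1.

(* A zero-energy Kepler motion, defined for all times: Hamilton's equations
   dq/dt = dH/dp, dp/dt = - dH/dq hold away from collisions.  The last clause is
   the regularization: after a collision the orbit is traced backwards.  The
   value of [p] at a collision time is irrelevant. *)
Definition kepler_motion (R : realType) (q p : R -> R * R) : Prop :=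
  [/\ continuous q,
      forall t : R, q t <> 0 ->
        [/\ is_derive t (1 : R) q (p t),
            is_derive t (1 : R) p (- ((enorm (q t) ^+ 3)^-1 *: q t))
          & hamiltonian (q t) (p t) = 0]
    & forall t : R, q t = 0 -> forall u : R, q (t + u) = q (t - u)].

(* Points of the phase cylinder are pairs (reflection point, angle). *)
Definition phase_cylinder (R : realType) (E : ellipse R) : set ((R * R) * R) :=
  [set x | ellipse_curve E x.1 /\ 0 < x.2 < pi].
Definition closed_phase_cylinder (R : realType) (E : ellipse R) :
    set ((R * R) * R) :=
  [set x | ellipse_curve E x.1 /\ 0 <= x.2 <= pi].

(* The velocity at [ellipse_pt E s] making the angle [theta] with the oriented
   tangent; its length is the one imposed by zero energy. *)
Definition outgoing_velocity (R : realType) (E : ellipse R) (s theta : R) :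
    R * R :=
  Num.sqrt (2 / enorm (ellipse_pt E s)) *:
  (cos theta *: unit_tangent E s + sin theta *: inward_normal E s).

(* Elastic reflection across the line spanned by the unit vector [e]. *)
Definition reflect_across (R : realType) (e w : R * R) : R * R :=
  (2 * dot w e) *: e - w.

(* Graph of the partial billiard map: [billiard_map E x y] means that T is
   defined at x and T x = y.  Since the angle of y lies in the open interval
   (0, pi), T is undefined at states whose next impact is tangential. *)
Definition billiard_map (R : realType) (E : ellipse R) (x y : (R * R) * R) :
    Prop :=
  phase_cylinder E x /\ phase_cylinder E y /\
  exists (q p : R -> R * R) (t s s' : R),
    [/\ kepler_motion q p,
        [/\ x.1 = ellipse_pt E s, q 0 = x.1 & p 0 = outgoing_velocity E s x.2],
        0 < t,
        forall u : R, 0 < u < t -> (ellipse_region E)° (q u)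
      & [/\ y.1 = ellipse_pt E s', q t = y.1
          & reflect_across (unit_tangent E s') (p t) =
            outgoing_velocity E s' y.2]].

(* [g], restricted to [0, 1], is a simple closed curve in [C]. *)
Definition simple_closed_curve_in (R : realType) (C : set ((R * R) * R))
    (g : R -> (R * R) * R) : Prop :=
  [/\ {within `[0, 1], continuous g},
      g 0 = g 1,
      forall u v : R, 0 <= u < 1 -> 0 <= v < 1 -> g u = g v -> u = v
    & forall u : R, 0 <= u <= 1 -> C (g u)].

Definition contractible_in (R : realType) (C : set ((R * R) * R))
    (g : R -> (R * R) * R) : Prop :=
  exists (h : R * R -> (R * R) * R) (c : (R * R) * R),
    [/\ {within `[0, 1] `*` `[0, 1], continuous h},
        forall l u : R, 0 <= l <= 1 -> 0 <= u <= 1 -> C (h (l, u)),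
        forall l : R, 0 <= l <= 1 -> h (l, 0) = h (l, 1)
      & forall u : R, 0 <= u <= 1 -> h (0, u) = g u /\ h (1, u) = c].

Definition rotational_curve (R : realType) (E : ellipse R)
    (Gam : set ((R * R) * R)) : Prop :=
  exists g : R -> (R * R) * R,
    [/\ simple_closed_curve_in (phase_cylinder E) g,
        ~ contractible_in (phase_cylinder E) g
      & Gam = g @` `[0, 1]].

Definition invariant_curve_2periodic (R : realType) (E : ellipse R)
    (Gam : set ((R * R) * R)) : Prop :=
  [/\ rotational_curve E Gam,
      [set y | exists2 x, Gam x & billiard_map E x y] = Gam
    & forall x, Gam x ->
        exists y, [/\ billiard_map E x y, billiard_map E y x & y <> x]].

(* The part of the open phase cylinder between [Gam] and the boundary component
   at angle [beta] (0 or pi): what can be joined to that component inside the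
   closed phase cylinder without meeting [Gam]. *)
Definition region_between (R : realType) (E : ellipse R)
    (Gam : set ((R * R) * R)) (beta : R) : set ((R * R) * R) :=
  [set x | phase_cylinder E x /\
    exists2 b, ellipse_curve E b &
      connected_component (closed_phase_cylinder E `\` Gam) (b, beta) x].

(* A function on the phase cylinder, read in the coordinates (s, theta).  As
   [ellipse_pt E] is an immersion covering the ellipse, this local
   diffeomorphism carries the C^1 structure of the phase cylinder. *)
Definition in_coords (R : realType) (E : ellipse R) (F : (R * R) * R -> R)
    (z : R * R) : R := F (ellipse_pt E z.1, z.2).

(* For [A] open in the phase cylinder; values of [F] off [A] play no role. *)
Definition C1_on (R : realType) (E : ellipse R) (A : set ((R * R) * R))
    (F : (R * R) * R -> R) : Prop :=
  forall z : R * R, A (ellipse_pt E z.1, z.2) ->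
    differentiable (in_coords E F) z /\
    forall v : R * R,
      {for z, continuous (fun w : R * R => 'd (in_coords E F) w v)}.

Definition nonvanishing_gradient_on (R : realType) (E : ellipse R)
    (A : set ((R * R) * R)) (F : (R * R) * R -> R) : Prop :=
  forall z : R * R, A (ellipse_pt E z.1, z.2) ->
    exists v : R * R, 'd (in_coords E F) z v <> 0.

Definition C1_first_integral (R : realType) (E : ellipse R)
    (A : set ((R * R) * R)) (F : (R * R) * R -> R) : Prop :=
  [/\ C1_on E A F,
      nonvanishing_gradient_on E A F
    & forall x y, A x -> A y -> billiard_map E x y -> F y = F x].

(* Main.v *)
Require Import Defs.
From mathcomp Require Import all_boot all_order all_algebra.
From mathcomp Require Import all_classical all_reals all_analysis.
From mathcomp Require Import ring lra.
From mathcomp Require Import complex.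
Import Order.TTheory GRing.Theory Num.Theory.
Import numFieldNormedType.Exports.
Local Open Scope classical_set_scope.
Local Open Scope ring_scope.
Set Implicit Arguments.
Unset Strict Implicit.
Unset Printing Implicit Defensive.

(** Squaring the complex plane turns straight lines into zero-energy Kepler
    orbits around the origin: if q = z ^ 2, the direction (conj z) p of the
    motion of z is constant, because its square (conj q) p ^ 2 and the angular
    momentum are (levi_civita_chord). Radial orbits come from the lines through
    the origin.

    Two consecutive arcs of a 2-periodic billiard orbit therefore lift to a
    chord from z0 to z1 and a chord from z1 to z2, where z2 ^ 2 = z0 ^ 2.  If
    z2 = z0, the chord is run back and forth, so it meets the lifted boundary at
    right angles. If z2 = - z0, then z0, z1, - z0, - z1 is a billiard
    parallelogram. The factorization z1 ^ 2 - z0 ^ 2 = (z1 - z0) (z1 + z0)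
    translates its reflection laws into those of the triangle O, w0 = z0 ^ 2,
    w1 = z1 ^ 2: the ray of light that leaves O and is reflected by the mirror
    at w0 and then at w1 comes back to O (closed_pair_of_arcs,
    two_periodic_dichotomy). Radial arcs do not occur, because they return to
    their starting point and give fixed points.

    In the second case w1 is a continuous function of w0, and so is the launch
    angle up to symmetry, which is never a right angle; hence both cases cannot
    occur on the connected curve Gam (mirror_triangle_everywhere). A rotational
    curve passes over every point of the ellipse, since otherwise it could be
    contracted away from the missing fiber (covers_ellipse). Above a point where
    the normal goes through O, the first case would give a radial arc, so the
    second case holds there, and thus everywhere: every ray of light from O
    returns to O after two reflections.

    A few of these rays determine O. The ray along a normal through O runs
    along a double normal of the ellipse, so O lies on an axis, unless the
    ellipse is a circle (normal_chord_axis). When O is on an axis but is not the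
    center, the ray to an end of the other axis returns only if O is a focus
    (vertex_orbit). When O is the center of an ellipse that is not a circle, the
    ray to an end of a latus rectum does not return (center_orbit). *)

(** * Vectors of the plane *)

Lemma dot_ge0 (R : realType) (v : R * R) : 0 <= dot v v.
Proof. by rewrite addr_ge0 // -expr2 sqr_ge0. Qed.

Lemma dot_eq0 (R : realType) (v : R * R) : dot v v = 0 -> v = 0.
Proof.
case: v => x y; rewrite /dot/= -!expr2 => /eqP.
rewrite paddr_eq0 ?sqr_ge0// !sqrf_eq0 => /andP[/eqP-> /eqP->].
by [].
Qed.

Lemma enorm_sqr (R : realType) (v : R * R) : enorm v ^+ 2 = dot v v.
Proof. by rewrite sqr_sqrtr ?dot_ge0. Qed.

Lemma enorm_gt0 (R : realType) (v : R * R) : v <> 0 -> 0 < enorm v.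
Proof.
move=> v0; rewrite sqrtr_gt0 lt_neqAle dot_ge0 andbT eq_sym.
by apply/eqP => /dot_eq0.
Qed.

Definition cross (R : realType) (v w : R * R) : R := v.1 * w.2 - v.2 * w.1.

Lemma scaleE (R : realType) (k : R) (v : R * R) :
  k *: v = (k * v.1, k * v.2).
Proof. by []. Qed.

Lemma enormZ (R : realType) (k : R) (v : R * R) : 0 < k ->
  enorm (k *: v) = k * enorm v.
Proof.
move=> k0; rewrite /enorm (_ : dot _ _ = k ^+ 2 * dot v v).
  by rewrite sqrtrM ?sqr_ge0// sqrtr_sqr gtr0_norm.
by rewrite /dot /= /GRing.scale/=; ring.
Qed.

Lemma reflectE (R : realType) (e w : R * R) : reflect_across e w =
  (2 * dot w e * e.1 - w.1, 2 * dot w e * e.2 - w.2).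
Proof. by []. Qed.

Lemma enorm_reflect (R : realType) (e w : R * R) : dot e e = 1 ->
  enorm (reflect_across e w) = enorm w.
Proof.
move=> e1; rewrite /enorm; congr Num.sqrt.
transitivity (4 * dot w e ^+ 2 * dot e e - 4 * dot w e ^+ 2 + dot w w).
  by rewrite reflectE /dot/=; ring.
by rewrite e1; ring.
Qed.

Lemma dotrr_rotate (R : realType) (phi : R) (v w : R * R) :
  dot (rotate phi v) (rotate phi w) = dot v w.
Proof.
rewrite /dot /rotate/= -[RHS]mul1r -(cos2Dsin2 phi); ring.
Qed.

Lemma cross_rotate (R : realType) (phi : R) (v w : R * R) :
  cross (rotate phi v) (rotate phi w) = cross v w.
Proof.
rewrite /cross /rotate/= -[RHS]mul1r -(cos2Dsin2 phi); ring.
Qed.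

Lemma enorm_rotate (R : realType) (phi : R) (v : R * R) :
  enorm (rotate phi v) = enorm v.
Proof. by rewrite /enorm dotrr_rotate. Qed.

Lemma rotateD (R : realType) (phi : R) (v w : R * R) :
  rotate phi (v + w) = rotate phi v + rotate phi w.
Proof. by rewrite /rotate/= [RHS]surjective_pairing/=; congr pair; ring. Qed.

Lemma rotateZ (R : realType) (phi k : R) (v : R * R) :
  rotate phi (k *: v) = k *: rotate phi v.
Proof.
by rewrite /rotate/= [RHS]surjective_pairing/= /GRing.scale/=; congr pair; ring.
Qed.

Lemma rotateN (R : realType) (phi : R) (v : R * R) :
  rotate phi (- v) = - rotate phi v.
Proof. by rewrite -scaleN1r rotateZ scaleN1r. Qed.

Lemma rotateK (R : realType) (phi : R) (v : R * R) :
  rotate (- phi) (rotate phi v) = v.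
Proof.
rewrite /rotate/= cosN sinN [RHS]surjective_pairing; congr pair.
  rewrite -[RHS]mul1r -(cos2Dsin2 phi); ring.
rewrite -[RHS]mul1r -(cos2Dsin2 phi); ring.
Qed.

Lemma reflect_rotate (R : realType) (phi : R) (e w : R * R) :
  reflect_across (rotate phi e) (rotate phi w) =
  rotate phi (reflect_across e w).
Proof.
by rewrite /reflect_across dotrr_rotate rotateD rotateZ rotateN.
Qed.

(** * Limits and derivatives of plane-valued functions *)

Section plane_limits.
Variables (R : realType) (T : Type) (F : set_system T).
Context {FF : Filter F}.
Implicit Types (f g : T -> R * R) (h k : T -> R) (v w : R * R).

Lemma cvg_fstv (U V : topologicalType) (f : T -> U * V) (v : U * V) :
  f @ F --> v -> (fun y => (f y).1) @ F --> v.1.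
Proof.
move=> h; apply: (@cvg_comp _ _ _ _ (fun x : U * V => x.1) _ _ _ h).
exact: (@cvg_fst _ _ (nbhs v.1) (nbhs v.2)).
Qed.

Lemma cvg_sndv (U V : topologicalType) (f : T -> U * V) (v : U * V) :
  f @ F --> v -> (fun y => (f y).2) @ F --> v.2.
Proof.
move=> h; apply: (@cvg_comp _ _ _ _ (fun x : U * V => x.2) _ _ _ h).
exact: (@cvg_snd _ _ (nbhs v.1) (nbhs v.2)).
Qed.

Lemma cvg_pairv h k (a b : R) : h @ F --> a -> k @ F --> b ->
  (fun y => (h y, k y) : R * R) @ F --> ((a, b) : R * R).
Proof. by move=> ha kb; have H := cvg_pair ha kb; exact: H. Qed.

Lemma cvg_dot f g v w : f @ F --> v -> g @ F --> w ->
  (fun y => dot (f y) (g y)) @ F --> dot v w.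
Proof.
move=> fv gw; have f1 := cvg_fstv fv; have f2 := cvg_sndv fv.
have g1 := cvg_fstv gw; have g2 := cvg_sndv gw.
exact: (cvgD (cvgM f1 g1) (cvgM f2 g2)).
Qed.

Lemma cvg_enorm f v : f @ F --> v -> (fun y => enorm (f y)) @ F --> enorm v.
Proof.
move=> fv; apply: (@cvg_comp _ _ _ (fun y => dot (f y) (f y)) (@Num.sqrt R)).
  exact: (cvg_dot fv fv).
exact: sqrt_continuous.
Qed.

Lemma cvg_rotate (phi : R) f v : f @ F --> v ->
  (fun y => rotate phi (f y)) @ F --> rotate phi v.
Proof.
move=> fv; have f1 := cvg_fstv fv; have f2 := cvg_sndv fv.
have c_ (c : R) : (fun=> c) @ F --> c by exact: cvg_cst.
apply: cvg_pairv.
  exact: (cvgB (cvgM (c_ _) f1) (cvgM (c_ _) f2)).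
exact: (cvgD (cvgM (c_ _) f1) (cvgM (c_ _) f2)).
Qed.

Lemma cvg_scalev h (a : R) f v : h @ F --> a -> f @ F --> v ->
  (fun y => h y *: f y) @ F --> a *: v.
Proof. by move=> ha fv; exact: cvgZ. Qed.

Lemma cvg_reflect f g v w : f @ F --> v -> g @ F --> w ->
  (fun y => reflect_across (f y) (g y)) @ F --> reflect_across v w.
Proof.
move=> fv gw; have c_ (c : R) : (fun=> c) @ F --> c by exact: cvg_cst.
exact: (cvgB (cvg_scalev (cvgM (c_ _) (cvg_dot gw fv)) fv) gw).
Qed.

End plane_limits.

Lemma is_derive_fst (R : realType) (f : R -> R * R) (t : R) (v : R * R) :
  is_derive t (1 : R) f v -> is_derive t (1 : R) (fun u => (f u).1) v.1.
Proof.
move=> [fd fv].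
have H : (fun h : R => h^-1 *: ((f (h *: (1:R) + t)) - f t)) @ 0^' --> v.
  by rewrite -fv; exact: fd.
have H1 : (fun h : R =>
    h^-1 *: ((f (h *: (1:R) + t)).1 - (f t).1)) @ 0^' --> v.1.
  exact: (cvg_fstv H).
apply: DeriveDef.
  by apply/cvg_ex; exists v.1.
exact: (cvg_lim (@norm_hausdorff _ _) H1).
Qed.

Lemma is_derive_snd (R : realType) (f : R -> R * R) (t : R) (v : R * R) :
  is_derive t (1 : R) f v -> is_derive t (1 : R) (fun u => (f u).2) v.2.
Proof.
move=> [fd fv].
have H : (fun h : R => h^-1 *: ((f (h *: (1:R) + t)) - f t)) @ 0^' --> v.
  by rewrite -fv; exact: fd.
have H1 : (fun h : R =>
    h^-1 *: ((f (h *: (1:R) + t)).2 - (f t).2)) @ 0^' --> v.2.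
  exact: (cvg_sndv H).
apply: DeriveDef.
  by apply/cvg_ex; exists v.2.
exact: (cvg_lim (@norm_hausdorff _ _) H1).
Qed.

Lemma is_derive_pair (R : realType) (f g : R -> R) (t a b : R) :
  is_derive t (1 : R) f a -> is_derive t (1 : R) g b ->
  is_derive t (1 : R) (fun u => (f u, g u) : R * R) (a, b).
Proof.
move=> [fd fv] [gd gv].
have H1 : (fun h : R => h^-1 *: ((f (h *: (1:R) + t)) - f t)) @ 0^' --> a.
  by rewrite -fv; exact: fd.
have H2 : (fun h : R => h^-1 *: ((g (h *: (1:R) + t)) - g t)) @ 0^' --> b.
  by rewrite -gv; exact: gd.
have H := cvg_pair H1 H2.
apply: DeriveDef.
  by apply/cvg_ex; exists (a, b); exact: H.
by apply: cvg_lim; [exact: norm_hausdorff | exact: H].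
Qed.

Lemma cst_of_derive0 (R : realType) (f : R -> R) (v : R) : 0 <= v ->
  (forall u, 0 <= u <= v -> is_derive u (1 : R) f 0) -> f v = f 0.
Proof.
move=> v0 df.
have cf : {within `[0, v], continuous f}.
  apply: derivable_within_continuous => u; rewrite in_itv/= => uv.
  by have [] := df u uv.
have df' u : u \in `]0, v[ -> is_derive u (1 : R) f 0.
  by rewrite in_itv/= => /andP[u0 uv]; apply: df; rewrite !ltW.
have [c _] := MVT_segment v0 df' cf.
by rewrite mul0r => /eqP; rewrite subr_eq0 => /eqP.
Qed.

Lemma lt_of_derive_gt0 (R : realType) (f df : R -> R) (v : R) : 0 < v ->
  (forall u, 0 <= u <= v -> is_derive u (1 : R) f (df u)) ->
  (forall u, 0 <= u <= v -> 0 < df u) -> f 0 < f v.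
Proof.
move=> v0 fdf dfp.
have cf : {within `[0, v], continuous f}.
  apply: derivable_within_continuous => u; rewrite in_itv/= => uv.
  by have [] := fdf u uv.
have fdf' u : u \in `]0, v[ -> is_derive u (1 : R) f (df u).
  by rewrite in_itv/= => /andP[u0 uv]; apply: fdf; rewrite !ltW.
have [c /[!in_itv]/= /andP[c0 cv] e] := MVT v0 fdf' cf.
by rewrite -subr_gt0 e subr0 mulr_gt0 ?dfp ?ltW.
Qed.

(** The first zero is the minimum of the identity on the compact set of
    zeros. *)
Lemma first_zero (R : realType) (f : R -> R) (t : R) :
  continuous f -> 0 <= t -> f t = 0 ->
  exists tc, [/\ 0 <= tc <= t, f tc = 0 & forall u, 0 <= u < tc -> f u <> 0].
Proof.
move=> cf t0 ft.
pose A := `[0, t] `&` f @^-1` [set 0].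
have cA : compact A.
  apply: (subclosed_compact _ (@segment_compact _ 0 t)); last by move=> u [].
  apply: closedI; first exact: interval_closed.
  by apply: preimage_closed => //; exact: closed_eq.
have A0 : A !=set0 by exists t; split => //=; rewrite in_itv/= t0 lexx.
have [tc] := compact_EVT_min A0 cA
  (continuous_subspaceT (fun x : R => @cvg_id _ (nbhs x))).
rewrite inE => -[/= /[!in_itv]/= tc0 ftc] tcmin.
exists tc; split=> // u /andP[u0 utc] fu.
have /tcmin : u \in A.
  rewrite inE; split=> //=; rewrite in_itv/= u0 (le_trans (ltW utc)) //.
  by case/andP: tc0.
by rewrite leNgt utc.
Qed.

Lemma IVT_half (R : realType) (f : R -> R) (u v : R) :
  continuous f -> f u = 0 -> f v = 1 -> exists c, f c = 2^-1.
Proof.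
move=> cf fu fv; have [uv|/ltW vu] := leP u v.
  have [|c _ fc] := @IVT _ f u v 2^-1 uv (continuous_subspaceT cf).
    by rewrite fu fv min_l ?max_r//; lra.
  by exists c.
have [|c _ fc] := @IVT _ f v u 2^-1 vu (continuous_subspaceT cf).
  by rewrite fu fv min_r ?max_l//; lra.
by exists c.
Qed.

(** * Zero-energy Kepler motions *)

(** With complex numbers this is (conj v) w ^ 2; on Kepler orbits of energy
    zero it is a conserved quantity equivalent to the Laplace-Runge-Lenz
    vector. *)
Definition lenz (R : realType) (v w : R * R) : R * R :=
  (v.1 * (w.1 ^+ 2 - w.2 ^+ 2) + 2 * v.2 * w.1 * w.2,
   2 * v.1 * w.1 * w.2 - v.2 * (w.1 ^+ 2 - w.2 ^+ 2)).

Section motion.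
Variables (R : realType) (q p : R -> R * R).
Hypothesis qp : kepler_motion q p.

Lemma kepler_energy t : q t <> 0 -> dot (p t) (p t) = 2 / enorm (q t).
Proof.
case: qp => _ H _ /H [_ _]; rewrite /hamiltonian enorm_sqr => /eqP.
by rewrite subr_eq0 => /eqP e; rewrite -e mulrCA divff ?mulr1// pnatr_eq0.
Qed.

Let dq1 t : q t <> 0 -> is_derive t (1 : R) (fun u => (q u).1) (p t).1.
Proof. by case: qp => _ H _ /H [/is_derive_fst]. Qed.
Let dq2 t : q t <> 0 -> is_derive t (1 : R) (fun u => (q u).2) (p t).2.
Proof. by case: qp => _ H _ /H [/is_derive_snd]. Qed.
Let dp1 t : q t <> 0 ->
  is_derive t (1 : R) (fun u => (p u).1) (- ((enorm (q t) ^+ 3)^-1 * (q t).1)).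
Proof. by case: qp => _ H _ /H [_ /is_derive_fst]. Qed.
Let dp2 t : q t <> 0 ->
  is_derive t (1 : R) (fun u => (p u).2) (- ((enorm (q t) ^+ 3)^-1 * (q t).2)).
Proof. by case: qp => _ H _ /H [_ /is_derive_snd]. Qed.

Lemma derive_cross t : q t <> 0 ->
  is_derive t (1 : R) (fun u => cross (q u) (p u)) 0.
Proof.
move=> q0; have D1 := dq1 q0; have D2 := dq2 q0.
have P1 := dp1 q0; have P2 := dp2 q0.
rewrite /cross.
apply: is_derive_eq.
by rewrite /GRing.scale/=; ring.
Qed.

Lemma derive_dot t : q t <> 0 ->
  is_derive t (1 : R) (fun u => dot (q u) (p u)) (enorm (q t))^-1.
Proof.
move=> q0; have D1 := dq1 q0; have D2 := dq2 q0.
have P1 := dp1 q0; have P2 := dp2 q0.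
have r0 : enorm (q t) != 0 by rewrite gt_eqF ?enorm_gt0.
rewrite /dot.
apply: is_derive_eq.
have := kepler_energy q0; have := enorm_sqr (q t).
rewrite /GRing.scale/= {1 2}/dot => e1 e2.
transitivity (2 / enorm (q t) - (enorm (q t) ^+ 3)^-1 * enorm (q t) ^+ 2).
  by rewrite e1 -e2; ring.
by field.
Qed.

Lemma derive_lenz1 t : q t <> 0 ->
  is_derive t (1 : R) (fun u => (lenz (q u) (p u)).1) 0.
Proof.
move=> q0; have D1 := dq1 q0; have D2 := dq2 q0.
have P1 := dp1 q0; have P2 := dp2 q0.
have r0 : enorm (q t) != 0 by rewrite gt_eqF ?enorm_gt0.
rewrite /lenz/=.
apply: is_derive_eq.
have := kepler_energy q0; have := enorm_sqr (q t).
rewrite /GRing.scale/= {1 2}/dot => e1 e2.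
transitivity ((p t).1 * (2 / enorm (q t))
   - 2 * (p t).1 * (enorm (q t) ^+ 3)^-1 * enorm (q t) ^+ 2).
  by rewrite e1 -e2; ring.
by field.
Qed.

Lemma derive_lenz2 t : q t <> 0 ->
  is_derive t (1 : R) (fun u => (lenz (q u) (p u)).2) 0.
Proof.
move=> q0; have D1 := dq1 q0; have D2 := dq2 q0.
have P1 := dp1 q0; have P2 := dp2 q0.
have r0 : enorm (q t) != 0 by rewrite gt_eqF ?enorm_gt0.
rewrite /lenz/=.
apply: is_derive_eq.
have := kepler_energy q0; have := enorm_sqr (q t).
rewrite /GRing.scale/= {1 2}/dot => e1 e2.
transitivity ((p t).2 * (2 / enorm (q t))
   - 2 * (p t).2 * (enorm (q t) ^+ 3)^-1 * enorm (q t) ^+ 2).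
  by rewrite e1 -e2; ring.
by field.
Qed.

Lemma cross_conserved t : 0 <= t -> (forall u, 0 <= u <= t -> q u <> 0) ->
  cross (q t) (p t) = cross (q 0) (p 0).
Proof.
move=> t0 H; apply: (@cst_of_derive0 _ (fun u => cross (q u) (p u)) _ t0).
by move=> u /H; exact: derive_cross.
Qed.

Lemma lenz_conserved t : 0 <= t -> (forall u, 0 <= u <= t -> q u <> 0) ->
  lenz (q t) (p t) = lenz (q 0) (p 0).
Proof.
move=> t0 H; rewrite (surjective_pairing (lenz (q t) _)).
rewrite [RHS]surjective_pairing; congr pair.
  apply: (@cst_of_derive0 _ (fun u => (lenz (q u) (p u)).1) _ t0) => u /H.
  exact: derive_lenz1.
apply: (@cst_of_derive0 _ (fun u => (lenz (q u) (p u)).2) _ t0) => u /H.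
exact: derive_lenz2.
Qed.

Lemma dot_increases t : 0 < t -> (forall u, 0 <= u <= t -> q u <> 0) ->
  dot (q 0) (p 0) < dot (q t) (p t).
Proof.
move=> t0 H; apply: (@lt_of_derive_gt0 _ (fun u => dot (q u) (p u))
  (fun u => (enorm (q u))^-1) _ t0) => u /H q0.
  exact: derive_dot.
by rewrite invr_gt0 enorm_gt0.
Qed.

Let qq_continuous : continuous (fun u => dot (q u) (q u)).
Proof. by move=> u; case: qp => /(_ u) cq _ _; exact: cvg_dot. Qed.

Lemma first_collision t : 0 <= t -> q 0 <> 0 ->
  (forall u, 0 <= u <= t -> q u <> 0) \/
  exists tc, [/\ 0 < tc <= t, q tc = 0 & forall u, 0 <= u < tc -> q u <> 0].
Proof.
move=> t0 q0.
have [H|/existsNP[s]] := pselect (forall u, 0 <= u <= t -> q u <> 0).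
  by left.
move=> /not_implyP[/andP[s0 st] /contrapT qs]; right.
have [] := first_zero qq_continuous s0; first by rewrite qs /dot/= mulr0 addr0.
move=> c [/andP[c0 cs] /dot_eq0 qc H]; exists c; split => //.
- rewrite (le_trans cs st) andbT lt_neqAle c0 andbT.
  by apply/eqP => c00; apply: q0; rewrite c00.
- by move=> u /H qu qu0; apply: qu; rewrite qu0 /dot/= mulr0 addr0.
Qed.

(** Lagrange's identity: the squares of the cross and dot products of q and p
    add up to |q|^2 |p|^2 = 2 |q|. *)
Lemma cross_sqr_le t : q t <> 0 ->
  cross (q t) (p t) ^+ 2 <= 2 * enorm (q t).
Proof.
move=> q0.
have -> : 2 * enorm (q t) = dot (q t) (q t) * dot (p t) (p t).
  rewrite kepler_energy // -enorm_sqr; field.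
  by rewrite gt_eqF ?enorm_gt0.
rewrite -subr_ge0 (_ : _ - _ = dot (q t) (p t) ^+ 2) ?sqr_ge0//.
by rewrite /dot /cross; ring.
Qed.

(** The angular momentum is conserved until the first collision, and
    cross_sqr_le then keeps the particle at a fixed distance from the center. *)
Lemma nonradial_no_collision t : q 0 <> 0 -> cross (q 0) (p 0) <> 0 ->
  0 <= t -> forall u, 0 <= u <= t -> q u <> 0.
Proof.
move=> q0 l0 t0; case: (first_collision t0 q0) => // -[c [/andP[c0 ct] qc H]].
set l := cross _ _ in l0.
(* By cross_sqr_le the distance to the center is at least l ^+ 2 / 2. *)
pose m := (l ^+ 2 / 2) ^+ 2.
have m0 : 0 < m.
  rewrite exprn_gt0// divr_gt0// lt_neqAle sqr_ge0 andbT eq_sym.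
  by rewrite sqrf_eq0; exact/eqP.
have far u : 0 <= u < c -> m <= dot (q u) (q u).
  move=> /andP[u0 uc]; have qu : q u <> 0 by apply: H; rewrite u0.
  rewrite -enorm_sqr /m ler_pXn2r ?nnegrE ?divr_ge0 ?sqr_ge0 ?sqrtr_ge0//.
  rewrite ler_pdivrMr// mulrC /l -(cross_conserved u0) ?cross_sqr_le//.
  by move=> v /andP[v0 vu]; apply: H; rewrite v0 (le_lt_trans vu).
have [|w] := @IVT _ _ 0 c (m / 2) (ltW c0)
    (continuous_subspaceT qq_continuous).
  have f0 : m <= dot (q 0) (q 0) by apply: far; rewrite lexx.
  have fc : dot (q c) (q c) = 0 by rewrite qc /dot/= mulr0 addr0.
  by rewrite fc ge_min le_max; apply/andP; split; apply/orP; [right|left]; lra.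
rewrite in_itv/= => /andP[w0 wc] e.
have wc' : w < c.
  rewrite lt_neqAle wc andbT; apply/eqP => wE.
  by move: e; rewrite wE qc /dot/= mulr0 addr0; lra.
have := far w; rewrite w0 wc' => /(_ isT); lra.
Qed.

(** On a radial orbit the Lenz vector is the direction of the position, so its
    conservation confines the particle to a ray. *)
Lemma radial_lenz t : q t <> 0 -> cross (q t) (p t) = 0 ->
  lenz (q t) (p t) = (2 / enorm (q t)) *: q t.
Proof.
move=> q0; rewrite -(kepler_energy q0) /cross /lenz /dot => c0.
rewrite [RHS]surjective_pairing /= /GRing.scale/=; congr pair.
  rewrite -[LHS]subr0 -(mulr0 (- 2 * (p t).2)) -c0; ring.
rewrite -[LHS]subr0 -(mulr0 (2 * (p t).1)) -c0; ring.
Qed.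

Lemma radial_ray t : q 0 <> 0 -> cross (q 0) (p 0) = 0 -> 0 <= t ->
  (forall u, 0 <= u <= t -> q u <> 0) -> exists2 k, 0 < k & q t = k *: q 0.
Proof.
move=> q0 c0 t0 H.
have qt : q t <> 0 by apply: H; rewrite t0 lexx.
have ct : cross (q t) (p t) = 0 by rewrite cross_conserved.
have r0 := enorm_gt0 q0; have rt := enorm_gt0 qt.
have := lenz_conserved t0 H; rewrite !radial_lenz// => e.
exists (enorm (q t) / enorm (q 0)); first by rewrite divr_gt0.
transitivity ((enorm (q t) / 2) *: ((2 / enorm (q t)) *: q t)).
  rewrite scalerA (_ : _ * _ = 1) ?scale1r//; field.
  by rewrite gt_eqF.
rewrite e scalerA; congr (_ *: _); field.
by rewrite gt_eqF.
Qed.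

(** After a collision the motion is reversed: the particle runs back along its
    ray and meets its starting point before it can reach any other place outside
    I. *)
Lemma radial_return t (I : set (R * R)) : q 0 <> 0 -> q t <> 0 ->
  cross (q 0) (p 0) = 0 -> 0 < t -> ~ I (q 0) ->
  (forall u, 0 < u < t -> I (q u)) -> exists2 k, 0 < k & q t = k *: q 0.
Proof.
move=> q0 qt c0 t0 nI inI.
have [H|[c [/andP[cp ct] qc H]]] := first_collision (ltW t0) q0.
  exact: (radial_ray q0 c0 (ltW t0) H).
have mirrored : q t = q (2 * c - t).
  case: qp => _ _ /(_ c qc (t - c)).
  rewrite addrC subrK => ->; congr q; ring.
have ct' : c < t.
  by rewrite lt_neqAle ct andbT; apply/eqP => e; apply: qt; rewrite -e.
have [t2c|t2c] := leP t (2 * c).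
  rewrite mirrored; apply: radial_ray => // [|u /andP[u0 uc]]; first lra.
  by apply: H; rewrite u0/=; lra.
exfalso; apply: nI; rewrite (_ : q 0 = q (2 * c)); first by apply: inI; lra.
case: qp => _ _ /(_ c qc c); rewrite subrr => <-; congr q; ring.
Qed.

End motion.

(** * Kepler arcs as chords of the square root plane *)

Local Open Scope complex_scope.

Definition cplx (R : realType) (v : R * R) : R[i] := v.1 +i* v.2.

Lemma cplx_inj (R : realType) : injective (@cplx R).
Proof. by move=> [a b] [c d] [-> ->]. Qed.

Lemma cplx_scale (R : realType) (k : R) (v : R * R) :
  cplx (k *: v) = k%:C * cplx v.
Proof.
rewrite /cplx/=; apply/eqP; rewrite complex.eq_complex/=.
by rewrite !mul0r subr0 addr0 !eqxx.
Qed.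

Lemma cplxB (R : realType) (v w : R * R) : cplx (v - w) = cplx v - cplx w.
Proof. by []. Qed.

Lemma cplxN (R : realType) (v : R * R) : cplx (- v) = - cplx v.
Proof. by []. Qed.

Lemma conj_real (R : realType) (x : R) : Num.conj (x%:C : R[i]) = x%:C.
Proof. exact: conjc_real. Qed.

Lemma conj_mul_cplx (R : realType) (v w : R * R) :
  (cplx v)^* * cplx w = dot v w +i* cross v w.
Proof.
apply/eqP; rewrite complex.eq_complex/= /dot /cross.
by apply/andP; split; apply/eqP; ring.
Qed.

Lemma cplx_lenz (R : realType) (v w : R * R) :
  cplx (lenz v w) = (cplx v)^* * cplx w ^+ 2.
Proof.
apply/eqP; rewrite complex.eq_complex/=.
by apply/andP; split; apply/eqP; ring.
Qed.

Lemma cplx_reflect (R : realType) (e w : R * R) : dot e e = 1 ->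
  cplx (reflect_across e w) = cplx e ^+ 2 * (cplx w)^*.
Proof.
rewrite /dot => e1; apply/eqP; rewrite complex.eq_complex/= /dot /GRing.scale/=.
apply/andP; split; apply/eqP.
  transitivity (2 * (w.1 * e.1 + w.2 * e.2) * e.1
    - (e.1 * e.1 + e.2 * e.2) * w.1); [by rewrite e1 mul1r | ring].
transitivity (2 * (w.1 * e.1 + w.2 * e.2) * e.2
  - (e.1 * e.1 + e.2 * e.2) * w.2); [by rewrite e1 mul1r | ring].
Qed.

(** Both sides are nonnegative and have the same square. *)
Lemma sqrt_cplx_norm (R : realType) (z : R[i]) (v : R * R) :
  z ^+ 2 = cplx v -> z * z^* = (enorm v)%:C.
Proof.
case: z => a b; move=> e.
have : (a ^+ 2 + b ^+ 2) ^+ 2 = enorm v ^+ 2.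
  case: e; rewrite enorm_sqr /dot => <- <-; ring.
move/eqP; rewrite eqrXn2 ?addr_ge0 ?sqr_ge0 ?sqrtr_ge0// => /eqP <-.
apply/eqP; rewrite complex.eq_complex/=.
by apply/andP; split; apply/eqP; ring.
Qed.

Lemma reflectK (R : realType) (e w : R * R) : dot e e = 1 ->
  reflect_across e (reflect_across e w) = w.
Proof.
move=> e1; apply: cplx_inj; rewrite !cplx_reflect// rmorphM/= conjCK mulrA.
rewrite rmorphXn/= -exprMn [cplx e * _]mulrC conj_mul_cplx e1.
rewrite (_ : _ +i* _ = 1) ?expr1n ?mul1r// /cross.
by apply/eqP; rewrite eq_complex/= mulrC subrr !eqxx.
Qed.

Lemma real_scale_norm (R : realType) (k : R) (d : R[i]) :
  (k%:C * d) * (k%:C * d)^* = k%:C ^+ 2 * (d * d^*).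
Proof. by rewrite rmorphM/= conj_real; ring. Qed.

Lemma energy_cplx (R : realType) (w p : R * R) : dot p p * enorm w = 2 ->
  (enorm w)%:C * ((cplx p)^* * cplx p) = 2.
Proof.
move=> E; rewrite conj_mul_cplx (_ : (_ +i* _) = (dot p p)%:C).
  by rewrite -rmorphM mulrC E rmorph_nat.
by rewrite /cross [p.2 * _]mulrC subrr.
Qed.

Lemma dotC2 (R : realType) (v w : R * R) :
  2 * (dot v w)%:C = (cplx v)^* * cplx w + (cplx w)^* * cplx v.
Proof.
rewrite !conj_mul_cplx -[2]/(2%:R) -(rmorph_nat (real_complex R)) -rmorphM.
apply/eqP; rewrite eq_complex/= /dot /cross.
by apply/andP; split; apply/eqP; ring.
Qed.

(** What remains of a collision-free motion once time is forgotten: the values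
    of the integrals of motion at both ends, and the growth of q.p. *)
Record kepler_arc (R : realType) (q0 p0 q1 p1 : R * R) : Prop := KeplerArc {
  arc_energy0 : dot p0 p0 * enorm q0 = 2;
  arc_energy1 : dot p1 p1 * enorm q1 = 2;
  arc_cross : cross q1 p1 = cross q0 p0;
  arc_lenz : lenz q1 p1 = lenz q0 p0;
  arc_dot : dot q0 p0 < dot q1 p1
}.

Lemma chord_direction_norm (R : realType) (q0 p0 : R * R) (z0 : R[i]) :
  dot p0 p0 * enorm q0 = 2 -> z0 ^+ 2 = cplx q0 ->
  (z0^* * cplx p0) * (z0^* * cplx p0)^* = 2.
Proof.
move=> E0 z0E; rewrite rmorphM/= conjCK.
rewrite (_ : _ * _ = (z0 * z0^*) * ((cplx p0)^* * cplx p0)); last by ring.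
rewrite (sqrt_cplx_norm z0E).
exact: energy_cplx.
Qed.

(** The chord that lifts a Kepler arc. Its direction d = (conj z) p is
    known up to sign by the Lenz vector. The imaginary part of (conj z) d is the
    angular momentum, so z1 - z0 is a real multiple of d; the real part is q.p,
    whose growth makes the multiple positive. *)
Lemma levi_civita_chord (R : realType) (q0 p0 q1 p1 : R * R) (z0 : R[i]) :
  kepler_arc q0 p0 q1 p1 ->
  z0 ^+ 2 = cplx q0 ->
  exists z1 (k : R), [/\ z1 ^+ 2 = cplx q1,
    z1^* * cplx p1 = z0^* * cplx p0, 0 < k &
    z1 - z0 = k%:C * (z0^* * cplx p0)].
Proof.
move=> [E0 _ ec el ed] z0E.
set d := z0^* * cplx p0.
have dd : d * d^* = 2 := chord_direction_norm E0 z0E.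
(* The sign of z1 is the one that makes the two directions agree. *)
have [z1 z1E z1d] : exists2 z1 : R[i], z1 ^+ 2 = cplx q1 & z1^* * cplx p1 = d.
  pose z := sqrtc (cplx q1).
  have : (z^* * cplx p1) ^+ 2 = d ^+ 2.
    rewrite /d !exprMn -!rmorphXn/= sqr_sqrtc z0E -!cplx_lenz.
    by rewrite el.
  move/eqP; rewrite eqf_sqr => /orP[]/eqP H.
    by exists z; rewrite ?sqr_sqrtc.
  by exists (- z); rewrite ?sqrrN ?sqr_sqrtc// rmorphN mulNr H opprK.
exists z1, ((dot q1 p1 - dot q0 p0) / 2).
split=> //; first by rewrite divr_gt0// subr_gt0.
have e : (z1 - z0)^* * d = (dot q1 p1 - dot q0 p0)%:C.
  rewrite rmorphB mulrBl -{1}z1d /d !mulrA -!expr2 -!rmorphXn/= z1E z0E.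
  rewrite !conj_mul_cplx; apply/eqP; rewrite complex.eq_complex/=.
  by rewrite ec subrr !eqxx.
have e' : (z1 - z0) * d^* = (dot q1 p1 - dot q0 p0)%:C.
  have := congr1 Num.conj e; rewrite rmorphM/= conjCK => ->.
  exact: conj_real.
rewrite rmorphM/= -e' fmorphV rmorph_nat.
transitivity ((z1 - z0) * (d * d^*) / 2); first by rewrite dd mulfK ?pnatr_eq0.
by ring.
Qed.

(** The lifts z0, z1, z2 of the two arcs satisfy z2 = z0 or z2 = - z0. In the
    second case the product of the two chords is w0 - w1, and the product of
    their directions, computed at z0 or at z1, is a reflected position. The last
    equation is the law of cosines at z0: the angle between the two chords there
    is twice the angle with the normal. *)
Lemma closed_pair_of_arcs (R : realType) (w0 p0 w1 p1 p1' p0' e0 e1 : R * R) :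
  w0 <> 0 -> w1 <> 0 -> dot e0 e0 = 1 -> dot e1 e1 = 1 ->
  kepler_arc w0 p0 w1 p1 -> kepler_arc w1 p1' w0 p0' ->
  p1' = reflect_across e1 p1 -> p0 = reflect_across e0 p0' ->
  dot p0 e0 = 0 \/
  exists k0 k1, [/\ 0 < k0, 0 < k1,
    w1 - w0 = k0 *: reflect_across e0 w0,
    w0 - w1 = k1 *: reflect_across e1 w1 &
    k0 * enorm w0 * (2 * dot p0 e0 ^+ 2 - dot p0 p0)
      = (enorm w1 - enorm w0) * dot p0 p0].
Proof.
move=> w00 w10 e0n e1n arc arc' r1 r0.
have [E0 E1 _ _ _] := arc; have [E1' E0' _ _ _] := arc'.
have z0E := sqr_sqrtc (cplx w0); set z0 := sqrtc _ in z0E.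
have [z1 [k [z1E z1d k0 zk]]] := levi_civita_chord arc z0E.
have [z2 [k' [z2E z2d k'0 zk']]] := levi_civita_chord arc' z1E.
set d := z0^* * cplx p0 in zk z1d.
set d' := z1^* * cplx p1' in zk' z2d.
have dn : d * d^* = 2 := chord_direction_norm E0 z0E.
have d'n : d' * d'^* = 2 := chord_direction_norm E1' z1E.
have z00 : z0 != 0.
  apply/eqP => z00; apply: w00; apply: cplx_inj; rewrite -z0E z00.
  by rewrite expr0n.
have : z2 ^+ 2 == z0 ^+ 2 by rewrite z2E z0E.
rewrite eqf_sqr => /orP[]/eqP z2z0; [left|right].
  (* z2 = z0: the chord is run back, so the velocity is reversed at z0. *)
  have kd : k%:C * d = - (k'%:C * d').
    by rewrite -zk -zk' z2z0 opprB.
  have kk : k = k'.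
    apply/eqP; rewrite -(@eqrXn2 _ 2) ?ltW//; apply/eqP.
    apply: (@complexI R); rewrite !rmorphXn/=.
    apply: (@mulIf _ 2); first by rewrite pnatr_eq0.
    have := congr1 (fun x => x * x^*) kd.
    by rewrite rmorphN mulrNN !real_scale_norm dn d'n.
  have dd' : d = - d'.
    apply: (@mulfI _ k%:C); last by rewrite kd kk mulrN.
    by apply/eqP => /(@complexI R) k00; move: k0; rewrite k00 ltxx.
  have pp : p0' = - p0.
    apply: cplx_inj; apply: (@mulfI _ z0^*); first by rewrite conjC_eq0.
    rewrite -{1}z2z0 z2d -[d']opprK -dd'.
    by rewrite /d -mulrN.
  move: r0; rewrite pp => /(congr1 (dot e0)) h.
  have : 2 * dot p0 e0 * dot e0 e0 = 0.
    rewrite -[RHS](subrr (dot e0 p0)) {2}h reflectE /dot/=; ring.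
  by rewrite e0n mulr1 => /eqP; rewrite mulf_eq0 pnatr_eq0 => /eqP.
(* z2 = - z0: z0, z1, - z0, - z1 is a parallelogram. *)
have rw0 := enorm_gt0 w00; have rw1 := enorm_gt0 w10.
pose m := k * k'.
have m0 : 0 < m by rewrite mulr_gt0.
have m2 : (2 * m)%:C = 2 * m%:C by rewrite rmorphM rmorph_nat.
have e01 : cplx (w0 - w1) = m%:C * (d * d').
  rewrite cplxB -z0E -z1E.
  transitivity ((z1 - z0) * (z2 - z1)); first by rewrite z2z0; ring.
  by rewrite zk zk' rmorphM/=; ring.
have dd0 : enorm w0 *: (w1 - w0) = (2 * m) *: reflect_across e0 w0.
  apply: cplx_inj; rewrite !cplx_scale cplx_reflect// -opprB cplxN e01.
  rewrite -z2d z2z0 rmorphN /d r0 cplx_reflect// -z0E rmorphXn/= m2.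
  rewrite -(energy_cplx E0').
  by ring.
have dd1 : enorm w1 *: (w0 - w1) = (2 * m) *: reflect_across e1 w1.
  apply: cplx_inj; rewrite !cplx_scale cplx_reflect// e01.
  rewrite -z1d /d' r1 cplx_reflect// -z1E rmorphXn/= m2.
  rewrite -(energy_cplx E1).
  by ring.
have cs : - m * enorm w0 * dot p0 p0' = enorm w0 - enorm w1.
  apply: (@complexI R); apply: (@mulIf _ 2); first by rewrite pnatr_eq0.
  have -> : (enorm w0 - enorm w1)%:C = z0 * z0^* - z1 * z1^*.
    by rewrite (sqrt_cplx_norm z0E) (sqrt_cplx_norm z1E) -rmorphB.
  (* Both sides are twice the real part of (z1 - z0) (z2 - z1)^*. *)
  transitivity ((z1 - z0) * (z2 - z1)^*
      + ((z1 - z0) * (z2 - z1)^*)^*); last first.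
    by rewrite z2z0 rmorphM/= !rmorphB/= !rmorphN/= !conjCK; ring.
  transitivity (- m%:C * (enorm w0)%:C * (2 * (dot p0 p0')%:C)).
    by rewrite [in LHS]rmorphM/= [in LHS]rmorphM/= rmorphN/=; ring.
  rewrite dotC2 -(sqrt_cplx_norm z0E) zk zk' -z2d z2z0 /d /m rmorphM/=.
  by rewrite !rmorphM/= !rmorphN/= !conjCK !conj_real; ring.
exists (2 * m / enorm w0), (2 * m / enorm w1); split.
- by rewrite divr_gt0// mulr_gt0.
- by rewrite divr_gt0// mulr_gt0.
- by rewrite mulrC -scalerA -dd0 scalerA mulVf ?scale1r// gt_eqF.
- by rewrite mulrC -scalerA -dd1 scalerA mulVf ?scale1r// gt_eqF.
rewrite divfK ?gt_eqF//.
have -> : enorm w1 - enorm w0 = m * enorm w0 * dot p0 p0' by lra.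
have -> : p0' = reflect_across e0 p0 by rewrite r0 reflectK.
transitivity (m * (dot p0 p0 * enorm w0) * (2 * dot p0 e0 ^+ 2 - dot p0 p0)).
  by rewrite E0; ring.
by rewrite reflectE /dot/=; ring.
Qed.

(** The Lenz vector and the angular momentum determine the velocity at a given
    position, whereas q.p strictly increases. *)
Lemma arc_moves (R : realType) (w p p' : R * R) : w <> 0 -> cross w p <> 0 ->
  ~ kepler_arc w p w p'.
Proof.
move=> w0 c0 [_ _ ec el ed].
have := congr1 (@cplx R) el; rewrite !cplx_lenz.
move/(mulfI _) => h.
have /h/eqP : (Num.conj (cplx w)) != 0.
  by rewrite conjC_eq0; apply/eqP => /(@cplx_inj R w 0).
rewrite eqf_sqr => /orP[/eqP/cplx_inj pp|].
  by move: ed; rewrite pp ltxx.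
rewrite -cplxN => /eqP/cplx_inj pp; apply: c0.
by move: ec; rewrite pp /cross/=; lra.
Qed.

(** * Tangents of a conic *)

Definition qform (R : realType) (a b : R) (v w : R * R) : R :=
  v.1 * w.1 / a ^+ 2 + v.2 * w.2 / b ^+ 2.
Definition grad (R : realType) (a b : R) (P : R * R) : R * R :=
  (P.1 / a ^+ 2, P.2 / b ^+ 2).
Definition tang (R : realType) (a b : R) (P : R * R) : R * R :=
  (- (P.2 / b ^+ 2), P.1 / a ^+ 2).

Definition unit_tang (R : realType) (a b : R) (P : R * R) : R * R :=
  (enorm (tang a b P))^-1 *: tang a b P.

Lemma dot_grad (R : realType) (a b : R) (v P : R * R) :
  dot v (grad a b P) = qform a b v P.
Proof. by rewrite /dot /grad /qform/=; ring. Qed.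

Lemma qform_ge0 (R : realType) (a b : R) (v : R * R) : 0 <= qform a b v v.
Proof. by rewrite addr_ge0// divr_ge0 ?sqr_ge0// -expr2 sqr_ge0. Qed.

(** On the ray from o, qform - 1 is a convex quadratic that is negative at o, so
    it vanishes at most once. *)
Lemma ray_unique (R : realType) (a b k : R) (o r : R * R) :
  qform a b o o < 1 -> 0 < k -> qform a b (o + r) (o + r) = 1 ->
  qform a b (o + k *: r) (o + k *: r) = 1 -> k = 1.
Proof.
move=> o1 k0 e1 ek.
have : (1 - k) * ((qform a b o o - 1) - k * qform a b r r) = 0.
  transitivity ((qform a b (o + k *: r) (o + k *: r) - 1)
     - k * (qform a b (o + r) (o + r) - 1)); last by rewrite e1 ek; ring.
  by rewrite /qform scaleE/=; ring.
move/eqP; rewrite mulf_eq0 => /orP[/eqP|/eqP]; first lra.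
have := qform_ge0 a b r; nra.
Qed.

(** The tangent at P supports the ellipse, so an interior point o lies strictly
    on its inner side. *)
Lemma normal_pos (R : realType) (a b : R) (o P : R * R) :
  qform a b o o < 1 -> qform a b P P = 1 ->
  0 < qform a b (P - o) P.
Proof.
move=> + e; have := qform_ge0 a b (P - o); move: e.
have -> : qform a b (P - o) (P - o) =
  2 * qform a b (P - o) P - qform a b P P + qform a b o o.
  by rewrite /qform/=; ring.
lra.
Qed.

Section conic_tangent.
Variables (R : realType) (a b : R) (P : R * R).
Hypotheses (a0 : 0 < a) (b0 : 0 < b) (eP : qform a b P P = 1).

Let P_neq0 : P <> 0.
Proof.
move=> P0; move: eP; rewrite P0 /qform/= !mulr0 !mul0r addr0 => /eqP.
by rewrite eq_sym oner_eq0.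
Qed.

Lemma tang_neq0 : tang a b P <> 0.
Proof.
have a00 : a != 0 by rewrite gt_eqF.
have b00 : b != 0 by rewrite gt_eqF.
move: P_neq0; case: (P) => X Y P0 [] /eqP.
rewrite oppr_eq0 mulf_eq0 invr_eq0 expf_eq0 (negbTE b00) /= orbF => /eqP Y0.
move=> /eqP; rewrite mulf_eq0 invr_eq0 expf_eq0 (negbTE a00) /= orbF => /eqP X0.
by apply: P0; rewrite X0 Y0.
Qed.

Lemma unit_tang_unit : dot (unit_tang a b P) (unit_tang a b P) = 1.
Proof.
have r0 := enorm_gt0 tang_neq0.
by rewrite -enorm_sqr /unit_tang enormZ ?invr_gt0// mulVf ?expr1n// gt_eqF.
Qed.

End conic_tangent.

(** Equality would force r and v to point in opposite directions, which is
    impossible in an open half-plane. *)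
Lemma triangle_lt (R : realType) (a b : R) (r v P : R * R) :
  0 < qform a b r P -> 0 < qform a b v P ->
  enorm (r - v) < enorm r + enorm v.
Proof.
move=> rP vP.
have nz (w : R * R) : 0 < qform a b w P -> w <> 0.
  by move=> wP w0; move: wP; rewrite w0 /qform/= !mul0r addr0 ltxx.
have r0 := enorm_gt0 (nz _ rP); have v0 := enorm_gt0 (nz _ vP).
pose w := enorm r *: v + enorm v *: r.
have w0 : 0 < dot w w.
  rewrite lt_neqAle dot_ge0 andbT eq_sym; apply/eqP => /dot_eq0; apply: nz.
  rewrite (_ : qform _ _ _ _ =
      enorm r * qform a b v P + enorm v * qform a b r P).
    by rewrite addr_gt0// mulr_gt0.
  by rewrite /w /qform !scaleE/=; ring.
have wE : dot w w = 2 * (enorm r * enorm v) * (enorm r * enorm v + dot r v).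
  transitivity (enorm r ^+ 2 * dot v v + enorm v ^+ 2 * dot r r
    + 2 * (enorm r * enorm v) * dot r v).
    by rewrite /w /dot !scaleE/=; ring.
  by rewrite -!enorm_sqr; ring.
rewrite -(@ltr_pXn2r _ 2) ?nnegrE ?sqrtr_ge0 ?addr_ge0 ?sqrtr_ge0//.
rewrite enorm_sqr (_ : dot (r - v) (r - v) = dot r r + dot v v - 2 * dot r v);
  last by rewrite /dot/=; ring.
rewrite -!enorm_sqr; move: w0.
by rewrite wE pmulr_rgt0 ?mulr_gt0//; nra.
Qed.

(** * The billiard map in the axes of the ellipse *)

Definition to_axes (R : realType) (E : ellipse R) (x : R * R) : R * R :=
  rotate (- axis_angle E) (x - ellipse_center E).
Definition from_axes (R : realType) (E : ellipse R) (y : R * R) : R * R :=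
  ellipse_center E + rotate (axis_angle E) y.

Lemma from_axesK (R : realType) (E : ellipse R) :
  cancel (from_axes E) (to_axes E).
Proof. by move=> y; rewrite /to_axes /from_axes addrAC subrr add0r rotateK. Qed.

Lemma to_axesK (R : realType) (E : ellipse R) :
  cancel (to_axes E) (from_axes E).
Proof.
move=> x; rewrite /to_axes /from_axes -{1}(opprK (axis_angle E)) rotateK.
by rewrite addrC subrK.
Qed.

Section ellipse_frame.
Variables (R : realType) (E : ellipse R).
Let a := semi_major E.
Let b := semi_minor E.
Let phi := axis_angle E.

Lemma semi_major_gt0 : 0 < semi_major E.
Proof. exact: lt_le_trans (semi_minor_gt0 E) (semi_minor_le E). Qed.

Lemma ellipse_funE x : ellipse_fun E x = qform a b (to_axes E x) (to_axes E x).
Proof. by rewrite /ellipse_fun /qform /to_axes -/phi !expr_div_n !expr2. Qed.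

Lemma to_axes_ellipse_pt s :
  to_axes E (ellipse_pt E s) = (a * cos s, b * sin s).
Proof. exact: from_axesK. Qed.

Lemma ellipse_curveP x : ellipse_curve E x <->
  qform a b (to_axes E x) (to_axes E x) = 1.
Proof. by rewrite /ellipse_curve/= ellipse_funE. Qed.

Lemma unit_tangentE s :
  unit_tangent E s = rotate phi (unit_tang a b (to_axes E (ellipse_pt E s))).
Proof.
have D : is_derive s (1 : R) (ellipse_pt E)
    (rotate phi ((a * b) *: tang a b (to_axes E (ellipse_pt E s)))).
  rewrite to_axes_ellipse_pt.
  have D1 : is_derive s (1 : R) (fun s => (ellipse_center E).1
      + (cos phi * (a * cos s) - sin phi * (b * sin s)))
      (cos phi * (a * (- sin s)) - sin phi * (b * cos s)).
    by apply: is_derive_eq; rewrite /GRing.scale/=; ring.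
  have D2 : is_derive s (1 : R) (fun s => (ellipse_center E).2
      + (sin phi * (a * cos s) + cos phi * (b * sin s)))
      (sin phi * (a * (- sin s)) + cos phi * (b * cos s)).
    by apply: is_derive_eq; rewrite /GRing.scale/=; ring.
  rewrite (_ : rotate _ _ = (cos phi * (a * (- sin s)) - sin phi * (b * cos s),
      sin phi * (a * (- sin s)) + cos phi * (b * cos s))).
    exact: is_derive_pair D1 D2.
  rewrite scaleE /rotate /tang/=.
  by congr pair; field; rewrite !gt_eqF ?semi_minor_gt0 ?semi_major_gt0.
rewrite /unit_tangent derive1E derive_val /unit_tang rotateZ.
set t := tang _ _ _; set w := rotate phi t.
have ab0 : 0 < a * b by rewrite mulr_gt0 ?semi_minor_gt0 ?semi_major_gt0.
rewrite /= rotateZ -/w enormZ// -[enorm t](enorm_rotate phi) -/w scalerA.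
by rewrite invfM mulrC mulrA divff ?mul1r// gt_eqF.
Qed.

Lemma to_axesB x y : to_axes E x - to_axes E y = rotate (- phi) (x - y).
Proof. by rewrite /to_axes -rotateN -rotateD opprB addrA subrK. Qed.

(** Near an interior point, the region contains points that are farther from
    the center in the same direction. *)
Lemma interior_lt1 x :
  (ellipse_region E)° x -> qform a b (to_axes E x) (to_axes E x) < 1.
Proof.
move=> xI; rewrite ltNge; apply/negP => Q1.
have cg : (fun t : R => x + t *: (x - ellipse_center E)) @ (0 : R)^'+ --> x.
  have : (fun t : R => x + t *: (x - ellipse_center E)) @ (0 : R) -->
      x + 0 *: (x - ellipse_center E).
    by apply: cvgD; [exact: cvg_cst | apply: cvgZl; exact: cvg_id].
  rewrite scale0r addr0; apply: cvg_trans; apply: cvg_app.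
  exact: cvg_at_right_filter.
have H : \forall t \near (0 : R)^'+,
    0 < t /\ ellipse_region E (x + t *: (x - ellipse_center E)).
  apply: filterI; first exact: nbhs_right_gt.
  exact: (cg _ xI).
have [t [t0]] := filter_ex H.
rewrite /ellipse_region/= ellipse_funE.
rewrite (_ : to_axes E _ = (1 + t) *: to_axes E x); last first.
  by rewrite /to_axes -rotateZ scalerDl scale1r addrAC.
have -> : qform a b ((1 + t) *: to_axes E x) ((1 + t) *: to_axes E x) =
    (1 + t) ^+ 2 * qform a b (to_axes E x) (to_axes E x).
  by rewrite /qform scaleE/=; ring.
nra.
Qed.

End ellipse_frame.

Lemma sin_eq0_small (R : realType) (x : R) :
  - pi < x < pi -> sin x = 0 -> x = 0.
Proof.
move=> /andP[x1 x2] sx; have [x0|x0|//] := ltgtP x 0.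
  have : 0 < sin (- x) by apply: sin_gt0_pi; lra.
  by rewrite sinN sx oppr0 ltxx.
have : 0 < sin x by apply: sin_gt0_pi; lra.
by rewrite sx ltxx.
Qed.

Section billiard.
Variables (R : realType) (E : ellipse R).
Hypothesis hO : (ellipse_region E)° (0 : R * R).
Let a := semi_major E.
Let b := semi_minor E.
Let phi := axis_angle E.
Let o := to_axes E 0.

Lemma o_inside : qform a b o o < 1.
Proof. exact: interior_lt1. Qed.

Lemma curve_nonzero x : ellipse_curve E x -> x <> 0.
Proof.
by move=> /ellipse_curveP e x0; have := o_inside; rewrite /o -x0 e ltxx.
Qed.

Definition tangent_at (x : R * R) : R * R :=
  rotate phi (unit_tang a b (to_axes E x)).

(** The outgoing velocity read off the phase point, which does not depend on
    the parameter chosen on the ellipse. *)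
Definition launch (x : (R * R) * R) : R * R :=
  Num.sqrt (2 / enorm x.1) *:
  (cos x.2 *: tangent_at x.1
   + sin x.2 *: (- (tangent_at x.1).2, (tangent_at x.1).1)).

Lemma outgoing_velocityE s theta :
  outgoing_velocity E s theta = launch (ellipse_pt E s, theta).
Proof. by rewrite /outgoing_velocity /inward_normal unit_tangentE. Qed.

Lemma curve_ray x y k : ellipse_curve E x -> ellipse_curve E y -> 0 < k ->
  y = k *: x -> y = x.
Proof.
move=> /ellipse_curveP ex /ellipse_curveP ey k0 e.
have locE z : to_axes E z = o + rotate (- phi) z.
  by rewrite -[z in RHS]subr0 -to_axesB addrC subrK.
move: ex ey; rewrite e !locE rotateZ => ex ey.
by rewrite (ray_unique o_inside k0 ex ey) scale1r.
Qed.

(** A radial arc comes back to its starting point; any other arc is free of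
    collisions. *)
Lemma billiard_arc x y : billiard_map E x y ->
  exists2 p1, reflect_across (tangent_at y.1) p1 = launch y &
  (y.1 = x.1 /\ cross x.1 (launch x) = 0) \/
  (kepler_arc x.1 (launch x) y.1 p1 /\ cross x.1 (launch x) <> 0).
Proof.
move=> [[xc _] [[yc _] [q [p [t [s [s' arc]]]]]]].
case: arc => qp [xs q0 p0] t0 inI [ys qt refl].
have x0 := curve_nonzero xc; have y0 := curve_nonzero yc.
have p0E : p 0 = launch x.
  by rewrite p0 outgoing_velocityE -xs -surjective_pairing.
exists (p t).
  rewrite /tangent_at ys -unit_tangentE refl outgoing_velocityE -ys.
  by rewrite -surjective_pairing.
have q00 : q 0 <> 0 by rewrite q0.
have qt0 : q t <> 0 by rewrite qt.
have [c0|/eqP c0] := eqVneq (cross x.1 (launch x)) 0; [left|right]; split=> //.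
  have nI : ~ (ellipse_region E)° (q 0).
    rewrite q0 => /interior_lt1; move/ellipse_curveP: xc => ->.
    by rewrite ltxx.
  have [|k k0] := radial_return qp q00 qt0 _ t0 nI inI; first by rewrite q0 p0E.
  rewrite qt q0 => e; exact: curve_ray xc yc k0 e.
have c0' : cross (q 0) (p 0) <> 0 by rewrite q0 p0E.
have H := nonradial_no_collision qp q00 c0' (ltW t0).
split.
- by rewrite -p0E -q0 (kepler_energy qp q00) divfK ?gt_eqF ?enorm_gt0.
- by rewrite -qt (kepler_energy qp qt0) divfK ?gt_eqF ?enorm_gt0.
- by rewrite -p0E -q0 -qt (cross_conserved qp (ltW t0) H).
- by rewrite -p0E -q0 -qt (lenz_conserved qp (ltW t0) H).
- by rewrite -p0E -q0 -qt (dot_increases qp t0 H).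
Qed.

Lemma to_axes_curve x :
  ellipse_curve E x -> qform a b (to_axes E x) (to_axes E x) = 1.
Proof. by move/ellipse_curveP. Qed.

Lemma to_axes_sub x : x = rotate phi (to_axes E x - o).
Proof. by rewrite to_axesB subr0 -{1}(opprK phi) rotateK. Qed.

Lemma tangent_at_unit x :
  ellipse_curve E x -> dot (tangent_at x) (tangent_at x) = 1.
Proof.
move=> /to_axes_curve xc; rewrite dotrr_rotate.
exact: unit_tang_unit (semi_major_gt0 E) (semi_minor_gt0 E) xc.
Qed.

Lemma cross_tangent_gt0 x : ellipse_curve E x -> 0 < cross x (tangent_at x).
Proof.
move=> /to_axes_curve xc; rewrite {1}(to_axes_sub x) cross_rotate.
rewrite /unit_tang scaleE /cross/=.
have := mulr_gt0 (_ : 0 < (enorm (tang a b (to_axes E x)))^-1)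
  (normal_pos o_inside xc).
have tn := enorm_gt0 (tang_neq0 (semi_major_gt0 E) (semi_minor_gt0 E) xc).
rewrite invr_gt0 => /(_ tn).
by congr (0 < _); rewrite /qform/=; ring.
Qed.

Lemma dot_launch_tangent x : ellipse_curve E x.1 ->
  dot (launch x) (tangent_at x.1) = Num.sqrt (2 / enorm x.1) * cos x.2.
Proof.
move=> /tangent_at_unit; rewrite /launch !scaleE /dot/= => e.
by rewrite -[RHS]mulr1 -e; ring.
Qed.

Lemma dot_launch x : ellipse_curve E x.1 ->
  dot (launch x) (launch x) = Num.sqrt (2 / enorm x.1) ^+ 2.
Proof.
move=> /tangent_at_unit; rewrite /launch !scaleE /dot/= => e.
by rewrite -[RHS]mulr1 -e -[RHS]mulr1 -(cos2Dsin2 x.2); ring.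
Qed.

Lemma cross_launch x : cross x.1 (launch x) = Num.sqrt (2 / enorm x.1) *
  (cos x.2 * cross x.1 (tangent_at x.1) + sin x.2 * dot x.1 (tangent_at x.1)).
Proof. by rewrite /launch !scaleE /cross /dot/=; ring. Qed.

(** The inward radial direction at a point is unique, because the tangent is
    never radial. *)
Lemma radial_state_unique x y : ellipse_curve E x.1 -> 0 < x.2 < pi ->
  0 < y.2 < pi -> y.1 = x.1 -> cross x.1 (launch x) = 0 ->
  cross y.1 (launch y) = 0 -> y = x.
Proof.
case: x y => [w t] [w' t'] /= wc tpi t'pi ww; rewrite {w'}ww.
have w0 := curve_nonzero wc; have r0 := enorm_gt0 w0.
have c0 := cross_tangent_gt0 wc.
have cE u := cross_launch (w, u); rewrite /= in cE.
rewrite !cE; set s := Num.sqrt _; set e := tangent_at w in c0 *.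
have s0 : s != 0 by rewrite gt_eqF// sqrtr_gt0 divr_gt0.
move=> /eqP; rewrite mulf_eq0 (negbTE s0) /= => /eqP h1 /eqP.
rewrite mulf_eq0 (negbTE s0) /= => /eqP h2.
congr pair; apply/eqP; rewrite -subr_eq0; apply/eqP.
apply: sin_eq0_small; first lra.
rewrite sinB; apply: (@mulfI _ (cross w e)); first by rewrite gt_eqF.
rewrite mulr0.
transitivity ((cos t * cross w e + sin t * dot w e) * sin t'
  - (cos t' * cross w e + sin t' * dot w e) * sin t); first ring.
by rewrite h1 h2; ring.
Qed.

(** The light ray from O to x.1 is reflected at x.1 and at P back to O. The last
    equation then gives the launch angle x.2 of the Kepler orbit. *)
Definition mirror_triangle (x : (R * R) * R) : Prop :=
  exists P k k', [/\ [/\ 0 < k, 0 < k' & qform a b P P = 1],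
    P - to_axes E x.1 = k *: reflect_across (unit_tang a b (to_axes E x.1))
                                            (to_axes E x.1 - o),
    to_axes E x.1 - P = k' *: reflect_across (unit_tang a b P) (P - o) &
    k * enorm (to_axes E x.1 - o) * (2 * cos x.2 ^+ 2 - 1) =
    enorm (P - o) - enorm (to_axes E x.1 - o)].

(** Radial arcs are excluded: an arc of a 2-periodic orbit that returns to its
    starting point would be followed by another one, and both would leave that
    point in the same direction. *)
Lemma two_periodic_dichotomy x y :
  billiard_map E x y -> billiard_map E y x -> y <> x ->
  (x.2 = pi / 2 /\ cross x.1 (launch x) <> 0) \/ mirror_triangle x.
Proof.
move=> xy yx yNx; have [[xc xpi] [[yc ypi] _]] := xy.
have [p1 r1 C1] := billiard_arc xy; have [p0 r0 C0] := billiard_arc yx.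
have x0 := curve_nonzero xc; have y0 := curve_nonzero yc.
case: C1 => [[yx1 cx]|[ch1 cx]].
  case: C0 => [[_ cy]|[ch0 cy]].
    by exfalso; apply: yNx; exact: radial_state_unique.
  by exfalso; move: ch0; rewrite yx1; apply: arc_moves; rewrite // -yx1.
case: C0 => [[xy1 cy]|[ch0 cy]].
  by exfalso; move: ch1; rewrite xy1; apply: arc_moves; rewrite // -xy1.
have s0 : 0 < Num.sqrt (2 / enorm x.1) by rewrite sqrtr_gt0 divr_gt0 ?enorm_gt0.
have := closed_pair_of_arcs x0 y0 (tangent_at_unit xc) (tangent_at_unit yc)
  ch1 ch0 (esym r1) (esym r0).
rewrite dot_launch_tangent// dot_launch// => -[/eqP|].
  rewrite mulf_eq0 gt_eqF//= => /eqP cx0; left; split=> //.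
  have p0' := @pi_gt0 R.
  by apply: cos_inj; rewrite ?in_itv/= ?cx0 ?cos_pihalf//; lra.
move=> [k [k' [k0 k'0 e0 e1 ek]]]; right.
exists (to_axes E y.1), k, k'; split.
- by split=> //; exact: to_axes_curve.
- by rewrite to_axesB e0 rotateZ {2}(to_axes_sub x.1) reflect_rotate rotateK.
- by rewrite to_axesB e1 rotateZ {2}(to_axes_sub y.1) reflect_rotate rotateK.
have nrm z : enorm (to_axes E z - o) = enorm z.
  by rewrite -(enorm_rotate phi) -to_axes_sub.
rewrite !nrm.
apply: (@mulIf _ (Num.sqrt (2 / enorm x.1) ^+ 2)).
  by rewrite gt_eqF// exprn_gt0.
by rewrite -ek; ring.
Qed.

End billiard.

(** * Closed mirror paths through special points *)

Section mirror.
Variables (R : realType) (a b : R).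
Hypotheses (a0 : 0 < a) (b0 : 0 < b).

(** Reflection at P of the ray from o, with the chord P' - P resolved along the
    normal and the tangent at P instead of using a unit vector. *)
Definition bounce (o P P' : R * R) : Prop :=
  exists2 k, 0 < k & qform a b (P' - P) P = - k * qform a b (P - o) P /\
    dot (P' - P) (tang a b P) = k * dot (P - o) (tang a b P).

Lemma bounce_reflect k o P P' : qform a b P P = 1 -> 0 < k ->
  P' - P = k *: reflect_across (unit_tang a b P) (P - o) -> bounce o P P'.
Proof.
move=> eP k0 e; have m0 := enorm_gt0 (tang_neq0 a0 b0 eP).
exists k => //; rewrite e; move: (P - o) => r.
set m := enorm _ in m0; have mE : m ^+ 2 = dot (tang a b P) (tang a b P).
  exact: enorm_sqr.
have m00 : m != 0 by rewrite gt_eqF.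
have a00 : a != 0 by rewrite gt_eqF.
have b00 : b != 0 by rewrite gt_eqF.
rewrite !scaleE reflectE /unit_tang !scaleE -/m.
split.
  by rewrite /qform /tang /dot/=; field; rewrite m00 a00 b00.
transitivity (k * dot r (tang a b P) *
    (2 * (m ^+ 2)^-1 * dot (tang a b P) (tang a b P) - 1)).
  by rewrite /dot/=; field; rewrite ?m00 ?a00 ?b00.
by rewrite -mE mulfVK ?expf_neq0//; ring.
Qed.

(** The reflected ray goes back along the normal to P', where it must be
    reflected onto itself, so the chord is normal at both ends. This makes P and
    P' opposite, and a chord through the center is normal only along an axis. *)
Lemma normal_chord_axis o P P' : qform a b o o < 1 ->
  qform a b P P = 1 -> qform a b P' P' = 1 ->
  bounce o P P' -> bounce o P' P -> dot (P - o) (tang a b P) = 0 ->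
  [\/ a = b, o.1 = 0 | o.2 = 0].
Proof.
move=> o1 e e' [k k0 [vn vt]] [k' k'0 [vn' vt']] rt.
have rn := normal_pos o1 e; have rn' := normal_pos o1 e'.
have a00 : a != 0 by rewrite gt_eqF.
have b00 : b != 0 by rewrite gt_eqF.
rewrite rt mulr0 in vt.
pose n := grad a b P; pose n' := grad a b P'.
pose N := dot n n.
have N0 : N != 0.
  apply/eqP => /dot_eq0 n0; move: rn.
  by rewrite -dot_grad -/n n0 /dot/= !mulr0 addr0 ltxx.
have para v : dot v (tang a b P) = 0 -> N *: v = qform a b v P *: n.
  move=> h; rewrite !scaleE; congr pair.
    transitivity (qform a b v P * n.1 - n.2 * dot v (tang a b P)).
      by rewrite /N /n /dot /tang /grad /qform/=; ring.
    by rewrite h mulr0 subr0.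
  transitivity (qform a b v P * n.2 + n.1 * dot v (tang a b P)).
    by rewrite /N /n /dot /tang /grad /qform/=; ring.
  by rewrite h mulr0 addr0.
(* Both P - o and the chord v are multiples of the normal n; be and ga are the
   normal and tangential components of n at P'. *)
set q := qform a b (P - o) P in vn rn; set v := P' - P in vn vt.
set al := qform a b v P in vn.
pose be := qform a b n P'; pose ga := dot n (tang a b P').
have Nv := para v vt; have Nr := para (P - o) rt; rewrite -/al -/q in Nv Nr.
have Nr' : N *: (P' - o) = (al + q) *: n.
  by rewrite [in RHS]scalerDl -Nv -Nr -scalerDr /v addrA subrK.
have qZ c w : qform a b (c *: w) P' = c * qform a b w P'.
  by rewrite /qform scaleE/=; ring.
have dZ c w : dot (c *: w) (tang a b P') = c * dot w (tang a b P').
  by rewrite /dot scaleE/=; ring.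
have h1 : (al + q) * be = N * qform a b (P' - o) P'.
  by rewrite -(qZ (al + q)) -(qZ N) Nr'.
have be0 : be != 0.
  apply/eqP => bez; move: h1; rewrite bez mulr0 => /esym/eqP.
  by rewrite mulf_eq0 (negbTE N0) gt_eqF.
have h2 : al * be = k' * ((al + q) * be).
  have -> : al * be = N * qform a b v P' by rewrite -(qZ al) -Nv qZ.
  have -> : qform a b v P' = - qform a b (P - P') P' by rewrite /qform/=; ring.
  by rewrite vn' h1; ring.
have h3 : - (al * ga) = k' * ((al + q) * ga).
  have -> : al * ga = N * dot v (tang a b P') by rewrite -(dZ al) -Nv dZ.
  have -> : (al + q) * ga = N * dot (P' - o) (tang a b P').
    by rewrite -(dZ (al + q)) -Nr' dZ.
  have -> : dot v (tang a b P') = - dot (P - P') (tang a b P').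
    by rewrite /dot/=; ring.
  by rewrite vt'; ring.
have al0 : al < 0 by rewrite vn mulNr oppr_lt0 mulr_gt0.
have alE : al = k' * (al + q) by apply: (mulIf be0); rewrite h2 mulrA.
have ga0 : ga = 0.
  have : al * ga = 0 by rewrite mulrA -alE in h3; lra.
  by move/eqP; rewrite mulf_eq0 lt_eqF// => /eqP.
have col : P.2 * P'.1 = P.1 * P'.2.
  apply/eqP; rewrite -subr_eq0; apply/eqP.
  transitivity (a ^+ 2 * b ^+ 2 * ga); last by rewrite ga0 mulr0.
  by rewrite /ga /n /dot /grad /tang/=; field; rewrite a00 b00.
pose c := qform a b P P'.
have P'E : P' = c *: P.
  rewrite scaleE [LHS]surjective_pairing; congr pair.
    rewrite -[LHS]mulr1 -e.
    transitivity (P.1 * (P.1 * P'.1) / a ^+ 2 + P.2 * (P.2 * P'.1) / b ^+ 2).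
      by rewrite /qform; ring.
    by rewrite col /c /qform; ring.
  rewrite -[LHS]mulr1 -e.
  transitivity (P.1 * (P.1 * P'.2) / a ^+ 2 + P.2 * (P.2 * P'.2) / b ^+ 2).
    by rewrite /qform; ring.
  by rewrite -col /c /qform; ring.
(* P' is P or - P, and al < 0 excludes P. *)
have c2 : c ^+ 2 = 1.
  rewrite -e' P'E -[LHS]mulr1 -e /qform scaleE/=; ring.
have alc : al = c - 1 by rewrite /al /v /c -e /qform/=; ring.
have cN : c = - 1.
  move/eqP: c2; rewrite sqrf_eq1 => /orP[]/eqP// c1.
  by move: al0; rewrite alc c1 subrr ltxx.
have : P.1 * P.2 * (a ^+ 2 - b ^+ 2) = 0.
  transitivity (a ^+ 2 * b ^+ 2 / 2 * dot v (tang a b P)).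
    rewrite /v P'E cN scaleE /dot /tang/=; field; by rewrite a00 b00.
  by rewrite vt mulr0.
move/eqP; rewrite !mulf_eq0 subr_eq0 => /orP[/orP[]/eqP z|].
- apply: Or32; move: e rt.
  rewrite /qform /dot /tang/= z !mul0r add0r sub0r mulr0 addr0 mulrNN => e.
  move=> /eqP; rewrite mulf_eq0 => /orP[/eqP//|/eqP z2].
  by move: e; rewrite -mulrA z2 mulr0 => /eqP; rewrite eq_sym oner_eq0.
- apply: Or33; move: e rt; rewrite /qform /dot /tang/= z !mul0r addr0 sub0r.
  rewrite oppr0 mulr0 add0r => e /eqP; rewrite mulf_eq0 oppr_eq0.
  move=> /orP[/eqP//|/eqP z2].
  by move: e; rewrite -mulrA z2 mulr0 => /eqP; rewrite eq_sym oner_eq0.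
by rewrite eqrXn2 ?ltW// => /eqP; apply: Or31.
Qed.

(** The law of reflection at the vertex gives P' explicitly, with the parameter
    k fixed by the equation of the ellipse; the law at P' is then the equation
    of the focus. There is no order between a and b, so that the lemma applies
    to both axes. *)
Lemma vertex_orbit e P' : e != 0 -> qform a b P' P' = 1 ->
  bounce (e, 0) (0, b) P' -> bounce (e, 0) P' (0, b) ->
  e ^+ 2 = a ^+ 2 - b ^+ 2.
Proof.
move=> en0 e1 [k k0 [vn vt]] [k' k'0 [vn' vt']].
have a00 : a != 0 by rewrite gt_eqF.
have b00 : b != 0 by rewrite gt_eqF.
case: P' e1 vn vt vn' vt' => X Y e1 vn vt vn' vt'.
have YE : Y = b * (1 - k).
  move: vn; rewrite /qform/= => h.
  transitivity (b + b * ((X - 0) * 0 / a ^+ 2 + (Y - b) * b / b ^+ 2)).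
    by field; rewrite ?a00 ?b00.
  by rewrite h; field; rewrite a00 b00.
have XE : X = - (k * e).
  move: vt; rewrite /dot/= => h.
  transitivity (- b * ((X - 0) * - (b / b ^+ 2) + (Y - b) * (0 / a ^+ 2))).
    by field; rewrite a00 b00.
  by rewrite h; field; rewrite a00 b00.
have kE : k * (e ^+ 2 + a ^+ 2) = 2 * a ^+ 2.
  apply: (@mulfI _ k); first by rewrite gt_eqF.
  apply/eqP; rewrite -subr_eq0; apply/eqP.
  transitivity (a ^+ 2 * (qform a b (X, Y) (X, Y) - 1)).
    by rewrite YE XE /qform/=; field; rewrite a00 b00.
  by rewrite e1 subrr mulr0.
(* The law of reflection at P', with k' eliminated. *)
have : qform a b ((0, b) - (X, Y)) (X, Y)
      * dot ((X, Y) - (e, 0)) (tang a b (X, Y))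
    + dot ((0, b) - (X, Y)) (tang a b (X, Y))
      * qform a b ((X, Y) - (e, 0)) (X, Y) = 0.
  by rewrite vn' vt'; ring.
rewrite YE XE => h.
(* The normal components at P' of the chord and of P' - (e, 0). *)
have n1 : (k * e * - (k * e)) / a ^+ 2 + (k * b) * (b * (1 - k)) / b ^+ 2 = - k.
  transitivity (k - k / a ^+ 2 * (k * (e ^+ 2 + a ^+ 2))).
    by field; rewrite a00 b00.
  by rewrite kE; field.
have n2 : (- (k * e) - e) * - (k * e) / a ^+ 2
    + (b * (1 - k) - 0) * (b * (1 - k)) / b ^+ 2 = 3 - k.
  transitivity ((k + 1) / a ^+ 2 * (k * (e ^+ 2 + a ^+ 2)) + 1 - 3 * k).
    by field; rewrite a00 b00.
  by rewrite kE; field.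
have h2 : 2 * a ^+ 2 * (1 - k) + b ^+ 2 * k = 0.
  apply: (@mulfI _ (- (2 * k * e / (a ^+ 2 * b)))).
    rewrite oppr_eq0 !mulf_neq0 ?invr_eq0 ?mulf_neq0 ?expf_neq0// ?gt_eqF//.
  rewrite mulr0 -[RHS]h /qform/= opprK add0r.
  rewrite (_ : b - b * (1 - k) = k * b); last by ring.
  rewrite n1 n2 /dot /tang/=; field.
  by rewrite a00 b00.
have h3 : 2 * a ^+ 2 * (2 * a ^+ 2 - (e ^+ 2 + a ^+ 2)) = 2 * a ^+ 2 * b ^+ 2.
  rewrite -{2}kE.
  transitivity ((e ^+ 2 + a ^+ 2) *
      (b ^+ 2 * k - (2 * a ^+ 2 * (1 - k) + b ^+ 2 * k))); first by ring.
  by rewrite h2 subr0 -[in RHS]kE; ring.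
have : 2 * a ^+ 2 != 0 by rewrite mulf_neq0 ?expf_neq0.
by move=> /mulfI /(_ _ _ h3); lra.
Qed.

End mirror.

Definition swap (R : realType) (v : R * R) : R * R := (v.2, v.1).

Lemma bounce_swap (R : realType) (a b : R) (o P P' : R * R) :
  bounce a b o P P' -> bounce b a (swap o) (swap P) (swap P').
Proof.
move=> [k k0 [h1 h2]]; exists k => //; split.
  move: h1; rewrite /qform/= => h1; lra.
move: h2; rewrite /dot /tang/= => h2; lra.
Qed.

(** Coordinates of v in the frame of the unit vector u and its quarter turn. *)
Definition frame (R : realType) (u v : R * R) : R * R := (dot v u, cross u v).

Lemma frameB (R : realType) (u v w : R * R) :
  frame u (v - w) = frame u v - frame u w.
Proof.
rewrite [RHS]surjective_pairing /frame/=.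
by congr pair; rewrite /dot /cross/=; ring.
Qed.

Lemma qform_frame (R : realType) (a : R) (u v w : R * R) : dot u u = 1 ->
  qform a a (frame u v) (frame u w) = qform a a v w.
Proof.
move=> u1; rewrite -[RHS]mul1r -u1 /qform /frame /dot /cross/=; ring.
Qed.

Lemma dot_tang_frame (R : realType) (a : R) (u v w : R * R) : dot u u = 1 ->
  dot (frame u v) (tang a a (frame u w)) = dot v (tang a a w).
Proof.
move=> u1; rewrite -[RHS]mul1r -u1 /tang /frame /dot /cross/=; ring.
Qed.

Lemma bounce_frame (R : realType) (a : R) (u o P P' : R * R) : dot u u = 1 ->
  bounce a a o P P' -> bounce a a (frame u o) (frame u P) (frame u P').
Proof.
move=> u1 [k k0 [h1 h2]]; exists k => //.
by rewrite -!frameB !qform_frame// !dot_tang_frame.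
Qed.

(** With P and P' at the parameters t and t1 of the ellipse, the two reflection
    laws add up to an equation that forces sin (t + t1) = 0. So P' is the mirror
    image of P in an axis, which the law at P excludes for the end of the latus
    rectum above the focus (c, 0). *)
Lemma center_orbit (R : realType) (a b c : R) (P' : R * R) :
  0 < b -> b < a -> 0 < c -> c ^+ 2 = a ^+ 2 - b ^+ 2 ->
  qform a b P' P' = 1 -> bounce a b 0 (c, b ^+ 2 / a) P' ->
  bounce a b 0 P' (c, b ^+ 2 / a) -> False.
Proof.
move=> b0 ba c0 cE; have a0 : 0 < a by apply: lt_trans ba.
have a00 : a != 0 by rewrite gt_eqF.
have b00 : b != 0 by rewrite gt_eqF.
have ab : 0 < a ^+ 2 - b ^+ 2 by rewrite -cE exprn_gt0.
have [u [s [uE sE' cs sE [s0 u0]]]] : exists u s : R, [/\ c = a * u,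
    b ^+ 2 / a = b * s, u ^+ 2 + s ^+ 2 = 1, a ^+ 2 * s ^+ 2 = b ^+ 2 &
    0 < s /\ 0 < u].
  exists (c / a), (b / a); split; try by field.
    by rewrite !expr_div_n cE; field.
  by rewrite !divr_gt0.
case: P' => X Y /=; rewrite uE sE'.
rewrite (_ : (X, Y) = (a * (X / a), b * (Y / b))); last by congr pair; field.
move: (X / a) (Y / b) => c1 s1.
move: u s {uE sE' cE c0 c X Y} cs sE s0 u0 => c s cs sE s0 c0.
have qE x y x' y' : qform a b (a * x, b * y) (a * x', b * y') = x * x' + y * y'.
  by rewrite /qform/=; field; rewrite a00 b00.
have tE x y x' y' : a * b * dot (a * x, b * y) (tang a b (a * x', b * y')) =
    - a ^+ 2 * (x * y') + b ^+ 2 * (y * x').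
  by rewrite /dot/=; field; rewrite a00 b00.
rewrite qE => cs1 [k k0 [vn vt]] [k' k'0 [vn' vt']].
have diff x y x' y' : ((a * x, b * y) : R * R) - (a * x', b * y') =
    (a * (x - x'), b * (y - y')) by rewrite !mulrBr.
have kE : c * c1 + s * s1 = 1 - k.
  by move: vn; rewrite subr0 diff !qE -!expr2 cs; lra.
have k'E : k' = k.
  by move: vn'; rewrite subr0 diff !qE cs1; lra.
have I1 : - a ^+ 2 * (c1 * s) + b ^+ 2 * (s1 * c) =
    (b ^+ 2 - a ^+ 2) * (c * s) * (1 + k).
  move/(congr1 (fun x => a * b * x)): vt; rewrite subr0 diff.
  by rewrite mulrCA !tE; lra.
have I2 : - a ^+ 2 * (c * s1) + b ^+ 2 * (s * c1) =
    (b ^+ 2 - a ^+ 2) * (c1 * s1) * (1 + k).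
  move/(congr1 (fun x => a * b * x)): vt'; rewrite subr0 diff k'E.
  by rewrite mulrCA !tE; lra.
have sg : s1 * c + s * c1 = 0.
  have h : (c * s + c1 * s1) = (s1 * c + s * c1) * (1 - k).
    transitivity (c * s * (c1 * c1 + s1 * s1) + c1 * s1 * (c ^+ 2 + s ^+ 2)).
      by rewrite cs cs1; ring.
    by rewrite -kE; ring.
  have : (b ^+ 2 - a ^+ 2) * k ^+ 2 * (s1 * c + s * c1) = 0.
    transitivity ((- a ^+ 2 * (c1 * s) + b ^+ 2 * (s1 * c))
      + (- a ^+ 2 * (c * s1) + b ^+ 2 * (s * c1))
      - (b ^+ 2 - a ^+ 2) * (1 + k) * ((s1 * c + s * c1) * (1 - k))).
      by ring.
    by rewrite -h I1 I2; ring.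
  move/eqP; rewrite mulf_eq0 mulf_eq0 expf_eq0/= (gt_eqF k0) orbF.
  by rewrite lt_eqF/= => [/eqP//|]; rewrite -oppr_gt0 opprB.
pose e := c * c1 - s * s1.
have c1E : c1 = e * c.
  transitivity (c1 * (c ^+ 2 + s ^+ 2) - s * (s1 * c + s * c1));
    last by rewrite /e; ring.
  by rewrite cs sg; ring.
have s1E : s1 = - (e * s).
  transitivity (s1 * (c ^+ 2 + s ^+ 2) - c * (s1 * c + s * c1));
    last by rewrite /e; ring.
  by rewrite cs sg; ring.
have e2 : e ^+ 2 = 1.
  transitivity (e ^+ 2 * (c ^+ 2 + s ^+ 2)); first by rewrite cs mulr1.
  transitivity ((e * c) * (e * c) + - (e * s) * - (e * s)); first by ring.
  by rewrite -c1E -s1E.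
have J : (a ^+ 2 + b ^+ 2) * e =
    (a ^+ 2 - b ^+ 2) * (2 - e * (c ^+ 2 - s ^+ 2)).
  apply: (@mulfI _ (c * s)); first by rewrite mulf_neq0// gt_eqF.
  transitivity (- (- a ^+ 2 * (c1 * s) + b ^+ 2 * (s1 * c))).
    by rewrite s1E c1E; ring.
  rewrite I1 (_ : k = 1 - (c * c1 + s * s1)); last by rewrite kE; ring.
  by rewrite s1E c1E; ring.
(* The value 1 of e is the reflection in the first axis, - 1 in the second. *)
move/eqP: e2; rewrite sqrf_eq1 => /orP[]/eqP ee; rewrite ee in J.
  have : b ^+ 4 = 0.
    have h : (a ^+ 2 + b ^+ 2) * a ^+ 2 =
        (a ^+ 2 - b ^+ 2) * (a ^+ 2 + 2 * b ^+ 2).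
      rewrite -[a ^+ 2 + b ^+ 2]mulr1 J.
      have -> : 2 - 1 * (c ^+ 2 - s ^+ 2) = 1 + 2 * s ^+ 2 by lra.
      by rewrite -{3}sE; ring.
    lra.
  by move/eqP; rewrite expf_eq0 (negbTE b00).
have s2 : s ^+ 2 <= 1 by rewrite -cs lerDr sqr_ge0.
have := mulr_ge0 (ltW ab) (_ : 0 <= 1 + (c ^+ 2 - s ^+ 2) + 1); nra.
Qed.

(** In a circle every diameter is an axis, so rotating the frame reduces an
    arbitrary position of o to the horizontal axis. On the minor axis
    vertex_orbit gives a negative square. *)
Lemma focus_of_orbits (R : realType) (a b : R) (o : R * R) :
  0 < b -> b <= a ->
  (forall P, qform a b P P = 1 -> exists P', [/\ qform a b P' P' = 1,
     bounce a b o P P' & bounce a b o P' P]) ->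
  [\/ a = b, o.1 = 0 | o.2 = 0] -> o.2 = 0 /\ o.1 ^+ 2 = a ^+ 2 - b ^+ 2.
Proof.
move=> b0 ba H; have a0 : 0 < a by apply: lt_le_trans ba.
have a00 : a != 0 by rewrite gt_eqF.
have b00 : b != 0 by rewrite gt_eqF.
have [z0|/eqP o0] := eqVneq o 0.
  rewrite {}z0 in H *; move=> _; split=> //=; rewrite expr0n/=.
  have [ab|ab|->] := ltgtP b a; [|lra|by rewrite subrr].
  have d0 : 0 < a ^+ 2 - b ^+ 2 by nra.
  exfalso.
  pose c := Num.sqrt (a ^+ 2 - b ^+ 2).
  have c0 : 0 < c by rewrite sqrtr_gt0.
  have cE : c ^+ 2 = a ^+ 2 - b ^+ 2 by rewrite sqr_sqrtr// ltW.
  have [|P' [e' h h']] := H (c, b ^+ 2 / a).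
    rewrite /qform/= -expr2 cE; field; by rewrite a00 b00.
  exact: center_orbit b0 ab c0 cE e' h h'.
have horizontal : o.2 = 0 -> o.1 ^+ 2 = a ^+ 2 - b ^+ 2.
  move=> o2; have oE : o = (o.1, 0) by rewrite [LHS]surjective_pairing o2.
  have [|P' [e' h h']] := H (0, b).
    by rewrite /qform/=; field; rewrite a00 b00.
  rewrite oE in h h'; apply: vertex_orbit e' h h' => //.
  by apply/eqP => o1; apply: o0; rewrite oE o1.
case=> [ab|o1|o2]; last by split=> //; exact: horizontal.
- subst b; have r0 := enorm_gt0 o0; have r00 : enorm o != 0 by rewrite gt_eqF.
  pose u := (enorm o)^-1 *: o.
  have u1 : dot u u = 1.
    rewrite /u scaleE (_ : dot _ _ = (enorm o) ^- 2 * dot o o).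
      by rewrite -enorm_sqr mulVf// expf_neq0.
    by rewrite /dot/=; field.
  exfalso.
  have [|P' [e' h h']] := H (- (a * u.2), a * u.1).
    by rewrite -[RHS]u1 /qform /dot/=; field.
  have := bounce_frame u1 h; have := bounce_frame u1 h'.
  have -> : frame u o = (enorm o, 0).
    rewrite /frame /u scaleE /dot /cross/=; congr pair; last by ring.
    transitivity ((enorm o)^-1 * dot o o); first by rewrite /dot; ring.
    by rewrite -enorm_sqr; field.
  have -> : frame u (- (a * u.2), a * u.1) = (0, a).
    move: (u) u1 => w w1.
    rewrite /frame /dot /cross/=; congr pair; first by ring.
    transitivity (a * dot w w); last by rewrite w1 mulr1.
    by rewrite /dot; ring.
  move=> hs' hs.
  have := vertex_orbit a0 a0 r00 _ hs hs'.
  rewrite qform_frame// => /(_ e') /eqP.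
  by rewrite subrr expf_eq0 (negbTE r00).
- have [|P' [e' h h']] := H (a, 0).
    by rewrite /qform/=; field; rewrite a00 b00.
  have hs := bounce_swap h; have hs' := bounce_swap h'.
  rewrite /swap/= o1 in hs hs'.
  have : o.2 ^+ 2 = b ^+ 2 - a ^+ 2.
    apply: (vertex_orbit b0 a0 _ _ hs hs').
      by apply/eqP => o2; apply: o0; rewrite (surjective_pairing o) o1 o2.
    by rewrite -e' /qform/=; ring.
  have : b ^+ 2 <= a ^+ 2 by rewrite ler_pXn2r ?nnegrE ?(ltW a0) ?(ltW b0).
  have := sqr_ge0 o.2 => o2 ab e.
  have o2z : o.2 = 0 by apply/eqP; rewrite -sqrf_eq0; apply/eqP; lra.
  by split=> //; exact: horizontal.
Qed.

(** * The reflected chord as a function of its starting point *)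

Section conic_limits.
Variables (R : realType) (T : Type) (F : set_system T).
Context {FF : Filter F}.
Implicit Types (f g : T -> R * R) (v w : R * R).

Lemma cvg_tang (a b : R) f v : f @ F --> v ->
  (fun y => tang a b (f y)) @ F --> tang a b v.
Proof.
move=> fv; have f1 := cvg_fstv fv; have f2 := cvg_sndv fv.
have c_ (c : R) : (fun=> c) @ F --> c by exact: cvg_cst.
apply: cvg_pairv.
  exact: (cvgN (cvgM f2 (c_ _))).
exact: (cvgM f1 (c_ _)).
Qed.

Lemma cvg_qform (a b : R) f g v w : f @ F --> v -> g @ F --> w ->
  (fun y => qform a b (f y) (g y)) @ F --> qform a b v w.
Proof.
move=> fv gw; have f1 := cvg_fstv fv; have f2 := cvg_sndv fv.
have g1 := cvg_fstv gw; have g2 := cvg_sndv gw.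
have c_ (c : R) : (fun=> c) @ F --> c by exact: cvg_cst.
exact: (cvgD (cvgM (cvgM f1 g1) (c_ _)) (cvgM (cvgM f2 g2) (c_ _))).
Qed.

Lemma cvg_unit_tang (a b : R) f v : tang a b v <> 0 -> f @ F --> v ->
  (fun y => unit_tang a b (f y)) @ F --> unit_tang a b v.
Proof.
move=> v0 fv; apply: cvg_scalev; last exact: cvg_tang.
apply: cvgV; first by rewrite gt_eqF// enorm_gt0.
exact: (cvg_enorm (cvg_tang fv)).
Qed.

End conic_limits.

Section reflected_chord.
Variables (R : realType) (a b : R) (o : R * R).
Hypotheses (a0 : 0 < a) (b0 : 0 < b) (o1 : qform a b o o < 1).

(** The ray from o reflected at P follows the direction echo_dir and meets the
    ellipse again at echo_end. The positive quantity echo_gap compares the sides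
    of the triangle o, P, echo_end by the triangle inequality. *)
Definition echo_dir (P : R * R) : R * R :=
  reflect_across (unit_tang a b P) (P - o).
Definition echo_len (P : R * R) : R :=
  2 * qform a b (P - o) P / qform a b (echo_dir P) (echo_dir P).
Definition echo_end (P : R * R) : R * R := P + echo_len P *: echo_dir P.
Definition echo_gap (P : R * R) : R :=
  enorm (echo_end P - o) - enorm (P - o) + echo_len P * enorm (P - o).

Variable P : R * R.
Hypothesis eP : qform a b P P = 1.

Let a00 : a != 0. Proof. by rewrite gt_eqF. Qed.
Let b00 : b != 0. Proof. by rewrite gt_eqF. Qed.

Lemma qform_echo_dir : qform a b (echo_dir P) P = - qform a b (P - o) P.
Proof.
have m0 : enorm (tang a b P) != 0.
  by rewrite gt_eqF// enorm_gt0//; exact: tang_neq0 eP.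
rewrite /echo_dir; move: (P - o) => r; rewrite reflectE /unit_tang !scaleE.
by rewrite /qform /tang /dot/=; field; rewrite m0 a00 b00.
Qed.

(** If the direction were null for the form, qform would be affine along it and
    become negative. *)
Lemma echo_dir_gt0 : 0 < qform a b (echo_dir P) (echo_dir P).
Proof.
have rn := normal_pos o1 eP; have h := qform_echo_dir.
rewrite lt_neqAle qform_ge0 andbT eq_sym; apply/eqP => z.
have : 0 <= qform a b (P + (qform a b (P - o) P)^-1 *: echo_dir P)
    (P + (qform a b (P - o) P)^-1 *: echo_dir P) by exact: qform_ge0.
set k := (_)^-1.
have -> : qform a b (P + k *: echo_dir P) (P + k *: echo_dir P) =
  qform a b P P + 2 * k * qform a b (echo_dir P) P
  + k ^+ 2 * qform a b (echo_dir P) (echo_dir P).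
  by rewrite /qform !scaleE/=; ring.
rewrite z mulr0 addr0 eP h mulrN -mulrA mulVf ?gt_eqF//; lra.
Qed.

Lemma echo_len_gt0 : 0 < echo_len P.
Proof. by rewrite divr_gt0 ?echo_dir_gt0// mulr_gt0//; exact: normal_pos. Qed.

Lemma echo_end_curve : qform a b (echo_end P) (echo_end P) = 1.
Proof.
transitivity (qform a b P P + 2 * echo_len P * qform a b (echo_dir P) P
  + echo_len P ^+ 2 * qform a b (echo_dir P) (echo_dir P)).
  by rewrite /echo_end /qform !scaleE/=; ring.
rewrite eP qform_echo_dir /echo_len; field; by rewrite gt_eqF// echo_dir_gt0.
Qed.

Lemma echo_end_unique P' k : 0 < k -> qform a b P' P' = 1 ->
  P' - P = k *: echo_dir P -> k = echo_len P /\ P' = echo_end P.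
Proof.
move=> k0 e' pk; have PE : P' = P + k *: echo_dir P by rewrite -pk addrC subrK.
suff kE : k = echo_len P by rewrite PE kE.
rewrite /echo_len; apply: (@mulIf _ (qform a b (echo_dir P) (echo_dir P))).
  by rewrite gt_eqF// echo_dir_gt0.
rewrite divfK ?gt_eqF ?echo_dir_gt0//.
apply: (@mulfI _ k); first by rewrite gt_eqF.
apply/eqP; rewrite -subr_eq0; apply/eqP.
transitivity (qform a b P' P' - qform a b P P
   - 2 * k * (qform a b (echo_dir P) P + qform a b (P - o) P)).
  by rewrite PE /qform !scaleE/=; ring.
by rewrite e' eP qform_echo_dir; ring.
Qed.

(** The tangent at the end of the chord has o and P strictly on the same side,
    so the triangle inequality is strict. *)
Lemma echo_gap_gt0 : 0 < echo_gap P.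
Proof.
have e' := echo_end_curve; have k0 := echo_len_gt0.
set v := echo_len P *: echo_dir P.
have vE : echo_end P - P = v by rewrite /echo_end addrAC subrr add0r.
have vn : enorm v = echo_len P * enorm (P - o).
  by rewrite /v enormZ// enorm_reflect//; exact: unit_tang_unit eP.
have vpos : 0 < qform a b v (echo_end P).
  have pol (x y : R * R) : qform a b y x =
      (qform a b y y + qform a b x x - qform a b (x - y) (x - y)) / 2.
    by rewrite /qform/=; field; rewrite a00 b00.
  rewrite pol (_ : echo_end P - v = P); last by rewrite /echo_end addrK.
  rewrite e' eP addrK divr_gt0//.
  rewrite (_ : qform _ _ _ _ =
      echo_len P ^+ 2 * qform a b (echo_dir P) (echo_dir P)).
    by rewrite mulr_gt0 ?exprn_gt0 ?echo_dir_gt0.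
  by rewrite /v /qform !scaleE/=; ring.
have := triangle_lt (normal_pos o1 e') vpos.
rewrite (_ : echo_end P - o - v = P - o); last first.
  by rewrite /echo_end addrAC addrK.
by rewrite vn /echo_gap; lra.
Qed.

End reflected_chord.

(** * Following the invariant curve *)

Section clamp.
Variable R : realType.
Definition clamp (u : R) : R := Num.max 0 (Num.min u 1).

Lemma clamp_itv u : 0 <= clamp u <= 1.
Proof.
by rewrite /clamp le_max lexx /= ge_max ler01 ge_min lexx orbT.
Qed.

Lemma clamp_id u : 0 <= u <= 1 -> clamp u = u.
Proof.
move=> /andP[u0 u1]; rewrite /clamp (min_idPl _)//; exact/max_idPr.
Qed.

Lemma clamp_continuous : continuous clamp.
Proof.
move=> u.
have c_ (c : R) : {for u, continuous (fun _ : R => c)} by exact: cvg_cst.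
exact: (continuous_max (c_ 0) (continuous_min (@cvg_id _ (nbhs u)) (c_ 1))).
Qed.

(** Precomposing with clamp turns a path defined on the unit interval into a
    globally continuous one, which avoids subspace topologies below. *)
Lemma clamped_continuous (U : topologicalType) (g : R -> U) :
  {within `[0, 1], continuous g} -> continuous (g \o clamp).
Proof.
move=> /subspace_continuousP cg u P /= hP.
have cu : `[0, 1]%classic (clamp u) by rewrite /= in_itv/= clamp_itv.
have H := @clamp_continuous u _ (cg _ cu P hP).
apply: (@filterS _ (nbhs u) _ _ _ _ H) => y /= h; apply: h.
by rewrite in_itv/= clamp_itv.
Qed.
End clamp.

Section along_the_curve.
Variables (R : realType) (E : ellipse R).
Hypothesis hO : (ellipse_region E)° (0 : R * R).
Let a := semi_major E.
Let b := semi_minor E.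
Let phi := axis_angle E.
Let o := to_axes E 0.
Let a0 : 0 < a := semi_major_gt0 E.
Let b0 : 0 < b := semi_minor_gt0 E.
Let o1 : qform a b o o < 1 := o_inside hO.

Lemma cvg_to_axes (T : Type) (F : set_system T) {FF : Filter F}
    (f : T -> R * R) v :
  f @ F --> v -> (fun y => to_axes E (f y)) @ F --> to_axes E v.
Proof.
by move=> fv; apply: cvg_rotate; exact: (cvgB fv (cvg_cst (ellipse_center E))).
Qed.

Lemma cvg_from_axes (T : Type) (F : set_system T) {FF : Filter F}
    (f : T -> R * R) v :
  f @ F --> v -> (fun y => from_axes E (f y)) @ F --> from_axes E v.
Proof.
move=> fv; apply: cvgD; first exact: cvg_cst.
exact: cvg_rotate.
Qed.

(** By mirror_triangle_ratio this continuous function is 1 at mirror triangles,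
    while it vanishes at right angles. *)
Definition angle_ratio (x : (R * R) * R) : R :=
  2 * cos x.2 ^+ 2
  * (echo_len a b o (to_axes E x.1) * enorm (to_axes E x.1 - o))
  / echo_gap a b o (to_axes E x.1).

Lemma mirror_triangle_ratio x : ellipse_curve E x.1 ->
  mirror_triangle E x -> angle_ratio x = 1.
Proof.
move=> /to_axes_curve xc [P [k [k' [[k0 _ eP] e0 _ eth]]]].
have [kE PE] := echo_end_unique a0 b0 o1 xc k0 eP e0.
rewrite /angle_ratio; apply: (@mulIf _ (echo_gap a b o (to_axes E x.1))).
  by rewrite gt_eqF// echo_gap_gt0.
rewrite divfK ?mul1r; last by rewrite gt_eqF// echo_gap_gt0.
rewrite /echo_gap -kE -PE; move: eth; rewrite -/a -/b -/o; lra.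
Qed.

Lemma angle_ratio_continuous (g : R -> (R * R) * R) : continuous g ->
  (forall u, ellipse_curve E (g u).1) ->
  continuous (fun u => angle_ratio (g u)).
Proof.
move=> cg gc u; have ec := to_axes_curve (gc u).
have g1 : (fun y => (g y).1) @ u --> (g u).1 by exact: (cvg_fstv (cg u)).
have g2 : (fun y => (g y).2) @ u --> (g u).2 by exact: (cvg_sndv (cg u)).
have c_ (c : R) : (fun=> c) @ u --> c by exact: cvg_cst.
have co : (fun=> o) @ u --> o by exact: cvg_cst.
pose P := fun y => to_axes E (g y).1.
have cP : P @ u --> P u by exact: cvg_to_axes.
have cr : (fun y => P y - o) @ u --> P u - o.
  exact: (cvgB cP co).
have cdir : (fun y => echo_dir a b o (P y)) @ u --> echo_dir a b o (P u).
  apply: cvg_reflect => //; apply: cvg_unit_tang => //.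
  exact: (tang_neq0 a0 b0 ec).
have clen : (fun y => echo_len a b o (P y)) @ u --> echo_len a b o (P u).
  have h1 : (fun y => qform a b (P y - o) (P y)) @ u -->
      qform a b (P u - o) (P u) by exact: cvg_qform.
  have h2 : (fun y =>
      qform a b (echo_dir a b o (P y)) (echo_dir a b o (P y))) @ u -->
      qform a b (echo_dir a b o (P u)) (echo_dir a b o (P u)).
    exact: cvg_qform.
  apply: cvgM; first exact: (cvgM (c_ 2) h1).
  by apply: cvgV => //; rewrite gt_eqF// echo_dir_gt0.
have cend : (fun y => echo_end a b o (P y)) @ u --> echo_end a b o (P u).
  apply: cvgD => //; exact: cvg_scalev.
have cn : (fun y => enorm (P y - o)) @ u --> enorm (P u - o).
  exact: cvg_enorm.
have cn' : (fun y => enorm (echo_end a b o (P y) - o)) @ u -->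
    enorm (echo_end a b o (P u) - o).
  by apply: cvg_enorm; exact: (cvgB cend co).
have cgap : (fun y => echo_gap a b o (P y)) @ u --> echo_gap a b o (P u).
  exact: (cvgD (cvgB cn' cn) (cvgM clen cn)).
have ccos : (fun y => cos (g y).2) @ u --> cos (g u).2.
  apply: (@cvg_comp _ _ _ (fun y => (g y).2) (@cos R) _ _ _ g2).
  exact: continuous_cos.
have ccos2 : (fun y => cos (g y).2 ^+ 2) @ u --> cos (g u).2 ^+ 2.
  exact: (cvgM ccos ccos).
apply: cvgM; last by apply: cvgV => //; rewrite gt_eqF// echo_gap_gt0.
exact: (cvgM (cvgM (c_ 2) ccos2) (cvgM clen cn)).
Qed.

(** Along the curve angle_ratio takes only the values 0 and 1, so it is
    constant. *)
Lemma mirror_triangle_everywhere (g : R -> (R * R) * R) (u0 : R) :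
  {within `[0, 1], continuous g} ->
  (forall u, 0 <= u <= 1 -> ellipse_curve E (g u).1) ->
  (forall u, 0 <= u <= 1 -> (g u).2 = pi / 2 \/ mirror_triangle E (g u)) ->
  0 <= u0 <= 1 -> mirror_triangle E (g u0) ->
  forall u, 0 <= u <= 1 -> mirror_triangle E (g u).
Proof.
move=> cg gc gd u01 m0 u u1.
have [//|nm] := pselect (mirror_triangle E (g u)).
have cG : continuous (fun v => g (clamp v)) by exact: (clamped_continuous cg).
have Gc v : ellipse_curve E (g (clamp v)).1 by apply: gc; exact: clamp_itv.
have cR := angle_ratio_continuous cG Gc.
have A v : (g (clamp v)).2 = pi / 2 -> angle_ratio (g (clamp v)) = 0.
  by move=> h; rewrite /angle_ratio /= h cos_pihalf expr0n/= mulr0 !mul0r.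
have B v : mirror_triangle E (g (clamp v)) -> angle_ratio (g (clamp v)) = 1.
  by move=> h; apply: mirror_triangle_ratio.
have [|h0] := gd (clamp u) (clamp_itv u); last by rewrite clamp_id in h0.
move=> /A ru; have ru0 : angle_ratio (g (clamp u0)) = 1.
  by apply: B; rewrite clamp_id.
have [c] := IVT_half cR ru ru0.
by case: (gd (clamp c) (clamp_itv c)) => [/A|/B] ->; lra.
Qed.

End along_the_curve.

Section coverage.
Variables (R : realType) (E : ellipse R).
Let a := semi_major E.
Let b := semi_minor E.
Let a0 : 0 < a := semi_major_gt0 E.
Let b0 : 0 < b := semi_minor_gt0 E.

(** The affine map that sends the ellipse to the unit circle. *)
Definition to_circle (x : R * R) : R * R :=
  ((to_axes E x).1 / a, (to_axes E x).2 / b).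
Definition from_circle (v : R * R) : R * R := from_axes E (a * v.1, b * v.2).

Lemma to_circleK : cancel to_circle from_circle.
Proof.
move=> x; rewrite /from_circle /to_circle/= -[RHS](to_axesK E); congr from_axes.
have e k (t : R) : 0 < k -> k * (t / k) = t.
  by move=> k0; rewrite mulrC divfK// gt_eqF.
by rewrite !e// -surjective_pairing.
Qed.

Lemma to_circle_unit x :
  ellipse_curve E x -> dot (to_circle x) (to_circle x) = 1.
Proof.
move=> /to_axes_curve <-; rewrite /to_circle /qform /dot -/a -/b/=; field.
by rewrite !gt_eqF.
Qed.

Lemma from_circle_curve v : dot v v = 1 -> ellipse_curve E (from_circle v).
Proof.
move=> v1; apply/ellipse_curveP.
rewrite -[RHS]v1 /from_circle from_axesK /qform /dot -/a -/b/=; field.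
by rewrite !gt_eqF.
Qed.

(** The segment from v to - w contains the origin only if v = w. *)
Lemma segment_nonzero (l : R) (v w : R * R) : 0 <= l <= 1 -> dot v v = 1 ->
  dot w w = 1 -> v <> w -> (1 - l) *: v - l *: w <> 0.
Proof.
move=> /andP[l0 l1] v1 w1 vw z.
have vw1 : dot v w < 1.
  have : 0 < dot (v - w) (v - w).
    rewrite lt_neqAle dot_ge0 andbT eq_sym; apply/eqP => /dot_eq0/eqP.
    by rewrite subr_eq0 => /eqP.
  rewrite (_ : dot (v - w) _ = dot v v + dot w w - 2 * dot v w).
    by rewrite v1 w1; lra.
  by rewrite /dot/=; ring.
have e : (1 - 2 * l) ^+ 2 + 2 * (l * (1 - l)) * (1 - dot v w) = 0.
  transitivity (dot ((1 - l) *: v - l *: w) ((1 - l) *: v - l *: w));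
    last first.
    by rewrite z /dot/= mulr0 addr0.
  transitivity ((1 - l) ^+ 2 * dot v v + l ^+ 2 * dot w w
     - 2 * (l * (1 - l)) * dot v w); first by rewrite v1 w1; ring.
  by rewrite /dot !scaleE/=; ring.
have ll : 0 <= l * (1 - l) by rewrite mulr_ge0// subr_ge0.
have h1 : 0 <= 2 * (l * (1 - l)) * (1 - dot v w).
  by apply: mulr_ge0; [exact: mulr_ge0 | rewrite subr_ge0 ltW].
have h2 := sqr_ge0 (1 - 2 * l).
have /eqP : 1 - 2 * l = 0 by apply/eqP; rewrite -sqrf_eq0; apply/eqP; lra.
rewrite subr_eq0 => /eqP l2.
have lE : l = 2^-1 by lra.
by move: e; rewrite lE; lra.
Qed.

(** If the curve avoids the fiber of x0, sliding its points straight to the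
    antipode of x0 in the disc, and projecting radially back to the circle,
    contracts it to a point; the angle is moved linearly to pi / 2. *)
Lemma covers_ellipse (g : R -> (R * R) * R) (x0 : R * R) :
  {within `[0, 1], continuous g} -> g 0 = g 1 ->
  (forall u, 0 <= u <= 1 -> phase_cylinder E (g u)) ->
  ~ contractible_in (phase_cylinder E) g -> ellipse_curve E x0 ->
  exists2 u, 0 <= u <= 1 & (g u).1 = x0.
Proof.
move=> cg g01 gC nc x0c; apply: contrapT => nx; apply: nc.
pose G u := g (clamp u).
have cG : continuous G by exact: (clamped_continuous cg).
have GC u : phase_cylinder E (G u) by apply: gC; exact: clamp_itv.
pose N (z : R * R) :=
  (1 - clamp z.1) *: to_circle (G z.2).1 - clamp z.1 *: to_circle x0.
pose h (z : R * R) : (R * R) * R := (from_circle ((enorm (N z))^-1 *: N z),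
  (1 - clamp z.1) * (G z.2).2 + clamp z.1 * (pi / 2)).
have N0 z : N z <> 0.
  apply: segment_nonzero; rewrite ?clamp_itv ?to_circle_unit//.
    by case: (GC z.2).
  move=> /(congr1 from_circle); rewrite !to_circleK => e; apply: nx.
  by exists (clamp z.2) => //; exact: clamp_itv.
have ch : continuous h.
  move=> z.
  have c1 : (fun y : R * R => clamp y.1) @ z --> clamp z.1.
    apply: (@cvg_comp _ _ _ (fun y : R * R => y.1) (@clamp R) _ (nbhs z.1)).
      exact: cvg_fstv.
    exact: clamp_continuous.
  have cGz : (fun y : R * R => G y.2) @ z --> G z.2.
    apply: (@cvg_comp _ _ _ (fun y : R * R => y.2) G _ (nbhs z.2)).
      exact: cvg_sndv.
    exact: cG.
  have cG1 : (fun y : R * R => (G y.2).1) @ z --> (G z.2).1.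
    exact: (cvg_fstv cGz).
  have cG2 : (fun y : R * R => (G y.2).2) @ z --> (G z.2).2.
    exact: (cvg_sndv cGz).
  have c_ (c : R) : (fun=> c) @ z --> c by exact: cvg_cst.
  have c1' : (fun y : R * R => 1 - clamp y.1) @ z --> 1 - clamp z.1.
    exact: (cvgB (c_ 1) c1).
  have cN : N @ z --> N z.
    apply: cvgB; last by apply: cvg_scalev => //; exact: cvg_cst.
    apply: cvg_scalev => //.
    have cl : (fun y : R * R => to_axes E (G y.2).1) @ z -->
      to_axes E (G z.2).1 by exact: cvg_to_axes.
    have cl1 : (fun y : R * R => (to_axes E (G y.2).1).1) @ z -->
      (to_axes E (G z.2).1).1 by exact: cvg_fstv.
    have cl2 : (fun y : R * R => (to_axes E (G y.2).1).2) @ z -->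
      (to_axes E (G z.2).1).2 by exact: cvg_sndv.
    by apply: cvg_pairv; [exact: (cvgM cl1 (c_ _))|exact: (cvgM cl2 (c_ _))].
  have cU : (fun y => (enorm (N y))^-1 *: N y) @ z --> (enorm (N z))^-1 *: N z.
    apply: cvg_scalev => //; apply: cvgV; last exact: cvg_enorm.
    by rewrite gt_eqF// enorm_gt0.
  have cV : (fun y => from_circle ((enorm (N y))^-1 *: N y)) @ z -->
      from_circle ((enorm (N z))^-1 *: N z).
    apply: cvg_from_axes.
    have cU1 : (fun y => ((enorm (N y))^-1 *: N y).1) @ z -->
      ((enorm (N z))^-1 *: N z).1 by exact: (cvg_fstv cU).
    have cU2 : (fun y => ((enorm (N y))^-1 *: N y).2) @ z -->
      ((enorm (N z))^-1 *: N z).2 by exact: (cvg_sndv cU).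
    by apply: cvg_pairv; [exact: (cvgM (c_ _) cU1)|exact: (cvgM (c_ _) cU2)].
  have H := cvg_pair cV (cvgD (cvgM c1' cG2) (cvgM c1 (c_ (pi / 2)))).
  exact: H.
exists h, (h (1, 0)); split.
- exact: continuous_subspaceT.
- move=> l u _ _; rewrite /h/=; split=> /=.
    apply: from_circle_curve; have r0 := enorm_gt0 (N0 (l, u)).
    by rewrite -enorm_sqr enormZ ?invr_gt0// mulVf ?expr1n// gt_eqF.
  have [_ /andP[]] := GC u; have := clamp_itv l; have := @pi_gt0 R.
  by move: (clamp l) (G u).2 => c t; nra.
- move=> l _; have G01 : G 0 = G 1 by rewrite /G !clamp_id ?lexx ?ler01.
  by rewrite /h /N /= G01.
move=> u u01; split.
  have [gc _] := gC u u01.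
  have Gu : G u = g u by rewrite /G clamp_id.
  rewrite /h /N /= Gu clamp_id ?lexx ?ler01// subr0 !scale1r scale0r subr0.
  rewrite (_ : enorm _ = 1); last by rewrite /enorm to_circle_unit// sqrtr1.
  by rewrite invr1 scale1r to_circleK mul1r mul0r addr0 -surjective_pairing.
by rewrite /h /N /= [clamp 1]clamp_id ?lexx ?ler01// subrr !scale0r !mul0r.
Qed.

End coverage.

(** * Conclusion *)

(** The tangential component of P - o takes opposite values at the two ends of
    the first axis. *)
Lemma normal_through (R : realType) (a b : R) (o : R * R) : 0 < a -> 0 < b ->
  exists2 P, qform a b P P = 1 & dot (P - o) (tang a b P) = 0.
Proof.
move=> a0 b0; pose P (s : R) : R * R := (a * cos s, b * sin s).
have a00 : a != 0 by rewrite gt_eqF.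
have b00 : b != 0 by rewrite gt_eqF.
have eP s : qform a b (P s) (P s) = 1.
  by rewrite -(cos2Dsin2 s) /qform/=; field; rewrite a00 b00.
pose f s := dot (P s - o) (tang a b (P s)).
have cf : continuous f.
  move=> s; have c_ (c : R) : (fun=> c) @ s --> c by exact: cvg_cst.
  have co : (fun=> o) @ s --> o by exact: cvg_cst.
  have cP : P @ s --> P s.
    apply: cvg_pairv.
      exact: (cvgM (c_ a) (@continuous_cos R s)).
    exact: (cvgM (c_ b) (@continuous_sin R s)).
  apply: cvg_dot; first exact: (cvgB cP co).
  exact: cvg_tang.
have f0 : f 0 = - o.2 / a.
  by rewrite /f /P /dot /tang/= cos0 sin0; field; rewrite a00 b00.
have fpi : f pi = o.2 / a.
  by rewrite /f /P /dot /tang/= cospi sinpi; field; rewrite a00 b00.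
have [|s _ fs] := @IVT _ f 0 pi 0 (ltW (@pi_gt0 R)) (continuous_subspaceT cf).
  rewrite f0 fpi ge_min le_max mulNr oppr_le0 oppr_ge0.
  by have /orP[->|->] := le_total 0 (o.2 / a); rewrite ?orbT.
by exists (P s).
Qed.

Theorem theoremA (R : realType) (E : ellipse R)
    (Gam : set ((R * R) * R)) (beta : R)
    (hO : (ellipse_region E)° (0 : R * R))
    (hGam : invariant_curve_2periodic E Gam)
    (hbeta : beta = 0 \/ beta = pi)
    (hF : exists F : (R * R) * R -> R,
        C1_first_integral E (region_between E Gam beta) F) :
  is_focus E 0.
Proof.
case: hGam => -[g [[cg g01 _ gC] nc GamE]] _ per.
set a := semi_major E; set b := semi_minor E; set o := to_axes E 0.
have a0 : 0 < a := semi_major_gt0 E; have b0 : 0 < b := semi_minor_gt0 E.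
have ab : b <= a := semi_minor_le E.
have o1 : qform a b o o < 1 := o_inside hO.
have gc u : 0 <= u <= 1 -> ellipse_curve E (g u).1 by move=> /gC[].
have dich u : 0 <= u <= 1 ->
    ((g u).2 = pi / 2 /\ cross (g u).1 (launch E (g u)) <> 0)
    \/ mirror_triangle E (g u).
  move=> u01; have [|y [xy yx yNx]] := per (g u).
    by rewrite GamE; exists u => //=; rewrite in_itv.
  exact: two_periodic_dichotomy xy yx yNx.
have cover P : qform a b P P = 1 ->
    exists2 u, 0 <= u <= 1 & to_axes E (g u).1 = P.
  move=> eP.
  have [|u u01 e] := covers_ellipse (x0 := from_axes E P) cg g01 gC nc.
    by apply/ellipse_curveP; rewrite from_axesK.
  by exists u => //; rewrite e from_axesK.
have [P0 eP0 nP0] := normal_through o a0 b0.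
have [u0 u01 gu0] := cover P0 eP0.
have m0 : mirror_triangle E (g u0).
  (* A right angle at a point whose normal goes through the center would make
     the velocity radial. *)
  case: (dich u0 u01) => // -[th]; case.
  rewrite cross_launch th cos_pihalf sin_pihalf mul0r add0r mul1r.
  rewrite [X in dot X _](to_axes_sub E) dotrr_rotate gu0 /unit_tang scaleE.
  rewrite (_ : dot _ _ = (enorm (tang a b P0))^-1 * dot (P0 - o) (tang a b P0)).
    by rewrite nP0 !mulr0.
  by rewrite /dot/=; ring.
have right_or_mirror u : 0 <= u <= 1 ->
    (g u).2 = pi / 2 \/ mirror_triangle E (g u).
  by move=> /dich[[th _]|m]; [left | right].
have all_m := mirror_triangle_everywhere hO cg gc right_or_mirror u01 m0.
have paths P : qform a b P P = 1 -> exists P',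
    [/\ qform a b P' P' = 1, bounce a b o P P' & bounce a b o P' P].
  move=> eP; have [u u1 gu] := cover P eP.
  have [P' [k [k' [[k0 k'0 eP'] e e' _]]]] := all_m u u1.
  exists P'; split=> //.
    by apply: (bounce_reflect a0 b0 _ k0); rewrite -?gu// gu.
  by apply: (bounce_reflect a0 b0 _ k'0); rewrite -?gu.
have [P1 [eP1 b01 b10]] := paths P0 eP0.
have axis := normal_chord_axis a0 b0 o1 eP0 eP1 b01 b10 nP0.
have [z2 z1] := focus_of_orbits b0 ab paths axis.
have oE : o = (o.1, 0) by rewrite [LHS]surjective_pairing z2.
have center : ellipse_center E = - rotate (axis_angle E) (o.1, 0).
  by apply/eqP; rewrite -addr_eq0 -oE; apply/eqP; exact: (to_axesK E 0).
rewrite /is_focus -/a -/b -z1 sqrtr_sqr center.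
have [n0|n0] := leP 0 o.1.
  by left; rewrite ger0_norm// addNr.
right; rewrite ltr0_norm// (_ : (- o.1, 0) = - (o.1, 0)); last first.
  by rewrite -[RHS]/(_, _) oppr0.
by rewrite rotateN opprK addNr.
Qed.
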